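(* Fix an agent $i$. For each market size $n$ let $V_n\in[0,1]$ be the supremum of $\mathbb E[x_i(s)]$ over mechanisms for agent $i$ satisfying (P) and (IC) in the $n$-agent market; $V_n$ is nondecreasing in $n$ and let $V_\infty=\lim_n V_n$. Then there exist, for each $n$, thresholds $s_i^{\min}(n)\le s_i^{\max}(n)$, $\kappa(n)\in[0,1]$ and $\tau(n)\ge0$ such that the mechanism $$x_i(s_i,s_{-i};n)=\begin{cases}0 & s_i\le s_i^{\min}(n),\\ \kappa(n)\,\mathbb I\{\mathrm{LR}(s_{-i})\ge\tau(n)\} & s_i^{\min}(n)\le s_i\le s_i^{\max}(n),\\ 1 & s_i\ge s_i^{\max}(n)\end{cases}$$ satisfies (P) and (IC) in the $n$-agent market, and $|V_n-\mathbb E[x_i(s;n)]|\to0$ as $n\to\infty$.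
   Context: Setup (for each $n\ge2$). A state $\omega\in\{-1,+1\}$ is drawn with probability $1/2$ each. There are $n$ agents. Conditional on $\omega$, signals $s_1,\dots,s_n$ are i.i.d. with distribution $\mathbb F_\omega$ on $[0,1]$ (the same for all $n$), normalized so that $s_i=\mathbb P[\omega=+1\mid s_i]$. $\mathbb F_{-1},\mathbb F_{+1}$ are mutually absolutely continuous with densities; $\mathbb F=(\mathbb F_{-1}+\mathbb F_{+1})/2$ has density $f$ supported on a non-singleton interval in $[0,1]$, differentiable on its support with continuous derivative and $|f'/f|$ bounded. $\mathrm{LR}(s_{-i})=\prod_{k\ne i}\frac{s_k}{1-s_k}$. A mechanism for agent $i$ is measurable $x_i$ from signal profiles to $[0,1]$ (probability agent $i$ gets a good worth $\omega$ to her, else $0$). (P): $\mathbb E[\omega x_i(s_i,s_{-i})\mid s_i]\ge0$ for all types $s_i$; (IC): $\mathbb E[\omega x_i(s_i,s_{-i})\mid s_i]\ge\mathbb E[\omega x_i(\hat s_i,s_{-i})\mid s_i]$ for all types $s_i,\hat s_i$. *)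

(* Defs.v *)
From HB Require Import structures.
From mathcomp Require Import all_boot all_order all_algebra.
From mathcomp Require Import all_classical all_reals all_analysis.
Set Implicit Arguments. Unset Strict Implicit. Unset Printing Implicit Defensive.
Import Order.TTheory GRing.Theory Num.Theory.
Import numFieldNormedType.Exports.
Local Open Scope classical_set_scope.
Local Open Scope ring_scope.

Section Model.
Variable R : realType.

Definition leb := @lebesgue_measure R.

Fixpoint cube_int (m : nat) : (m.-tuple R -> R) -> R :=
  match m with
  | 0 => fun g => g [tuple]
  | k.+1 => fun g =>
      (\int[leb]_(t in `[0, 1]) cube_int (fun u : k.-tuple R => g [tuple of t :: u]))%R
  end.

(** Model primitives: [fm], [fp] are the densities of F_{-1}, F_{+1} on [0,1]. *)
Variables fm fp : R -> R.

Definition fmix (s : R) : R := (fm s + fp s) / 2.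

Definition model_assumptions : Prop :=
  measurable_fun setT fm /\ measurable_fun setT fp /\
      (forall s, 0 <= fm s /\ 0 <= fp s) /\
      (forall s, ~ (0 <= s <= 1) -> fm s = 0 /\ fp s = 0) /\
      ((\int[leb]_(s in `[0%R, 1%R]) (fm s)%:E)%E = 1%E /\
       (\int[leb]_(s in `[0%R, 1%R]) (fp s)%:E)%E = 1%E) /\
      (forall A : set R, measurable A -> A `<=` `[0, 1] ->
         ((\int[leb]_(s in A) (fm s)%:E)%E = 0%E <->
          (\int[leb]_(s in A) (fp s)%:E)%E = 0%E)) /\
      (* normalization s = P[omega = +1 | s] (uniform prior) *)
      (forall s, 0 < fm s + fp s -> (fp s / 2) / (fm s / 2 + fp s / 2) = s) /\
      (exists a b : R,
        0 <= a /\ a < b /\ b <= 1 /\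
            (forall s, 0 < fmix s -> a <= s <= b) /\
            (forall s, a < s < b -> 0 < fmix s) /\
            (forall s, a < s < b -> derivable fmix s 1) /\
            {in `]a, b[, continuous (derive1 fmix)} /\
            (exists M : R, forall s, a < s < b -> `|(derive1 fmix) s / fmix s| <= M)).

Definition is_type (s : R) : Prop := 0 < fmix s.

(** A mechanism for agent i in the n-agent market is a function of
    (s_i, s_{-i}), with s_{-i} the (n-1)-tuple of the other agents' signals. *)
Definition is_mechanism (n : nat) (x : R * (n.-1).-tuple R -> R) : Prop :=
  measurable_fun setT x /\ (forall p, 0 <= x p <= 1).

(** E[omega x(r, s_{-i}) | s_i = s] (Bayes' rule with prior 1/2). *)
Definition cond_payoff (n : nat) (x : R * (n.-1).-tuple R -> R) (s r : R) : R :=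
  ((fp s / 2) * cube_int (fun t => x (r, t) * \prod_(y <- t) fp y)
   - (fm s / 2) * cube_int (fun t => x (r, t) * \prod_(y <- t) fm y)) / fmix s.

Definition cond_P (n : nat) (x : R * (n.-1).-tuple R -> R) : Prop :=
  forall s, is_type s -> 0 <= cond_payoff x s s.

Definition cond_IC (n : nat) (x : R * (n.-1).-tuple R -> R) : Prop :=
  forall s r, is_type s -> is_type r -> cond_payoff x s r <= cond_payoff x s s.

Definition feasible (n : nat) (x : R * (n.-1).-tuple R -> R) : Prop :=
  [/\ is_mechanism x, cond_P x & cond_IC x].

Definition exp_alloc (n : nat) (x : R * (n.-1).-tuple R -> R) : R :=
  \int[leb]_(s in `[0, 1])
     cube_int (fun t => x (s, t) *
       ((fp s / 2) * \prod_(y <- t) fp y + (fm s / 2) * \prod_(y <- t) fm y)).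

Definition Vopt (n : nat) : R :=
  sup [set v | exists x : R * (n.-1).-tuple R -> R, feasible x /\ v = exp_alloc x].

Definition LR (m : nat) (t : m.-tuple R) : R := \prod_(y <- t) (y / (1 - y)).

(** x is given by the displayed threshold formula (at points where two cases
    of the formula apply, x takes the value of one of them). *)
Definition threshold_form (n : nat) (smin smax kappa tau : R)
    (x : R * (n.-1).-tuple R -> R) : Prop :=
  forall s t,
    (s <= smin /\ x (s, t) = 0)
    \/ (smin <= s <= smax /\ x (s, t) = kappa * (if tau <= LR t then 1 else 0))
    \/ (smax <= s /\ x (s, t) = 1).

End Model.

(* Main.v *)
Require Import Defs.
From HB Require Import structures.
From mathcomp Require Import all_boot all_order all_algebra.
From mathcomp Require Import all_classical all_reals all_analysis.
From mathcomp Require Import measurable_realfun.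
From mathcomp Require Import ring lra.
Set Implicit Arguments. Unset Strict Implicit. Unset Printing Implicit Defensive.
Import Order.TTheory GRing.Theory Num.Theory.
Import numFieldNormedType.Exports.
Local Open Scope classical_set_scope.
Local Open Scope ring_scope.

(** A report [r] gives agent [i] an option [(p, q)]: her probabilities of being
    served in the states +1 and -1.  Type [s] values it at [s p - (1 - s) q].
    Let [gain p q] be the expected allocation when everybody who prefers
    [(p, q)] to [(0, 0)] gets it.  The menu [(0,0), (p,q), (1,1)] with [q <= p]
    yields [gain p q + gain (1 - p) (1 - q)]; let [W] be the supremum.

    Upper bound, in every market: [gain] is homogeneous, so one-dimensional
    separation gives [l1 + l2 = W] with [gain p q <= l1 p + l2 q].  An incentive
    compatible menu increases with the type; cutting the types into cells of
    small mass, each increment of the option is accepted by all higher types, so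
    it contributes at most its [gain], and these bounds telescope to [W].

    Lower bound: for [0 < q <= p] the likelihood-ratio test with acceptance
    probabilities in ratio [q / p] exists because [LR] has no atoms, and it
    accepts almost surely in the state +1 as the market grows, by a Hellinger
    affinity estimate.  Scaled by [kappa] it approximates the option [(p, q)]. *)

(** * Integration over the unit interval *)

Section UnitIntegral.
Context {R : realType}.
Implicit Types (f g h : R -> R).

Notation mu := (@lebesgue_measure R).
Notation D := (`[0%R, 1%R]%classic : set R).

Definition uint g : R := \int[mu]_(t in D) g t.
Definition uintegrable g : Prop := mu.-integrable D (EFin \o g).

Lemma cube_intS k (g : k.+1.-tuple R -> R) :
  cube_int g = uint (fun t => cube_int (fun u : k.-tuple R => g [tuple of t :: u])).
Proof. by []. Qed.

Lemma uintegrable_dom h g : uintegrable h -> measurable_fun setT g ->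
  (forall t, `|g t| <= h t) -> uintegrable g.
Proof.
move=> ih mg gh; apply: le_integrable ih => //.
  exact/measurable_EFinP/measurable_funTS.
by move=> x _ /=; rewrite lee_fin (le_trans (gh x))// ler_norm.
Qed.

Lemma uintegrableZ k g : uintegrable g -> uintegrable (fun t => k * g t).
Proof.
move=> ig.
have := @integrableZl _ _ R mu D (measurable_itv _) k _ ig.
by apply: eq_integrable => // x _ /=; rewrite EFinM.
Qed.

Lemma uintegrableD f g :
  uintegrable f -> uintegrable g -> uintegrable (fun t => f t + g t).
Proof.
move=> i1 i2; have := @integrableD _ _ R mu D (measurable_itv _) _ _ i1 i2.
by apply: eq_integrable => // x _ /=; rewrite EFinD.
Qed.

Lemma uintD f g : uintegrable f -> uintegrable g ->
  uint (fun t => f t + g t) = uint f + uint g.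
Proof. by move=> ? ?; rewrite /uint RintegralD. Qed.

Lemma uintZ k g : uintegrable g -> uint (fun t => k * g t) = k * uint g.
Proof. by move=> ?; rewrite /uint RintegralZl. Qed.

Lemma eq_uint f g : (forall t, 0 <= t <= 1 -> f t = g t) -> uint f = uint g.
Proof.
by move=> fg; apply: eq_Rintegral => t; rewrite inE/= in_itv/=; exact: fg.
Qed.

Lemma uint_oo g : uintegrable g -> uint g = \int[mu]_(t in `]0%R, 1%R[) g t.
Proof.
move=> ig; rewrite /uint -Rintegral_itv_obnd_cbnd; last first.
  by apply: integrableS ig => //; apply: subset_itv; rewrite bnd_simp.
rewrite -Rintegral_itv_bndo_bndc//.
by apply: integrableS ig => //; apply: subset_itv; rewrite bnd_simp.
Qed.

(** The endpoints are null, so comparisons may assume [0 < t < 1], where the odds of a signal are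
    finite and positive. *)
Lemma le_uint f g : uintegrable f -> uintegrable g ->
  (forall t, 0 < t < 1 -> f t <= g t) -> uint f <= uint g.
Proof.
move=> i1 i2 fg; rewrite !uint_oo//; apply: le_Rintegral => //.
- by apply: integrableS i1 => //; apply: subset_itv; rewrite bnd_simp.
- by apply: integrableS i2 => //; apply: subset_itv; rewrite bnd_simp.
Qed.

Lemma eq_uint_oo f g : uintegrable f -> uintegrable g ->
  (forall t, 0 < t < 1 -> f t = g t) -> uint f = uint g.
Proof.
by move=> i1 i2 fg; apply/eqP; rewrite eq_le !le_uint// => t /fg ->.
Qed.

Lemma uint_ge0 g : (forall t, 0 <= t <= 1 -> 0 <= g t) -> 0 <= uint g.
Proof.
by move=> g0; apply: Rintegral_ge0 => t; rewrite /= in_itv/=; exact: g0.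
Qed.

Lemma eq_uint_off1 c f g : measurable_fun setT f -> measurable_fun setT g ->
  (forall t, t != c -> f t = g t) -> uint f = uint g.
Proof.
move=> mf mg fg; rewrite /uint /Rintegral; congr fine; apply: ae_eq_integral => //.
- exact/measurable_EFinP/measurable_funTS.
- exact/measurable_EFinP/measurable_funTS.
exists [set c]; split; [exact: measurable_set1|exact: lebesgue_measure_set1|].
move=> t /= /not_implyP[_ fgt]; apply: contrapT => tc; apply: fgt.
by rewrite fg//; apply/eqP.
Qed.

(** As [w n] tends to [c], the indicators converge wherever [phi t != c], hence off at most three
    points; dominated convergence with bound [h] concludes. *)
Lemma continuous_tail (h phi : R -> R) :
  measurable_fun setT h -> (forall t, 0 <= h t) -> uintegrable h ->
  measurable_fun setT phi ->
  (forall c, exists x, forall t, 0 < t < 1 -> t != x -> phi t != c) ->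
  continuous (fun c => uint (fun t => h t * (if c <= phi t then 1 else 0))).
Proof.
move=> mh h0 ih mphi level c.
have mtail c' : measurable_fun setT (fun t => h t * (if c' <= phi t then 1 else 0)).
  apply: measurable_funM => //; apply: measurable_fun_ifT => //.
  exact: measurable_fun_ler.
have itail c' : uintegrable (fun t => h t * (if c' <= phi t then 1 else 0)).
  apply: uintegrable_dom ih (mtail _) _ => t.
  by case: ifP => _; rewrite ?mulr1 ?mulr0 ?normr0// ger0_norm.
apply/(@cvg_nbhsP _ R^o) => w wc; apply: fine_cvg; rewrite fineK; last first.
  exact: (@integrable_fin_num _ _ R mu D (measurable_itv _) _ (itail c)).
have [x lx] := level c.
pose F n t := (h t * (if w n <= phi t then 1 else 0))%:E.
pose F0 t := (h t * (if c <= phi t then 1 else 0))%:E.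
suff [_ _] : [/\ mu.-integrable D F0,
    [sequence \int[mu]_(t in D) `|F n t - F0 t|]_n @ \oo --> 0 &
    [sequence \int[mu]_(t in D) F n t]_n @ \oo --> \int[mu]_(t in D) F0 t]%E by [].
apply: (@dominated_convergence _ _ R mu D (measurable_itv _) F F0 (EFin \o h)) => //.
- by move=> n; apply/(@measurable_EFinP _ _ _ D (fun t => h t * _))/measurable_funTS.
- exact/(@measurable_EFinP _ _ _ D (fun t => h t * _))/measurable_funTS.
- exists [set 0; 1; x]; split.
  + by apply: measurableU => //; apply: measurableU.
  + apply/countable_lebesgue_measure0/finite_set_countable.
    by rewrite !finite_setU; split; [split|]; exact: finite_set1.
  + move=> t /= /not_implyP[]; rewrite in_itv/= => /andP[t0 t1] ncv.
    apply: contrapT => /not_orP[/not_orP[/eqP t0' /eqP t1'] /eqP tx]; apply: ncv.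
    apply: cvg_EFin; first exact: nearW.
    have phic : phi t != c by apply: lx => //; rewrite !lt_neqAle eq_sym t0' t0 t1' t1.
    apply: cvg_near_cst.
    move: phic; rewrite neq_lt => /orP[phic|phic].
    * near=> n; rewrite /= [c <= _]leNgt phic /= leNgt.
      suff -> : phi t < w n by [].
      by near: n; exact: (cvgr_gt c).
    * near=> n; rewrite /= (ltW phic).
      suff -> : w n <= phi t by [].
      by near: n; exact: (cvgr_le c).
- apply/aeW => t n _ /=; rewrite lee_fin.
  by case: ifP => _; rewrite ?mulr1 ?mulr0 ?normr0// ger0_norm.
Unshelve. all: by end_near. Qed.

(** A zero integral would make [g] vanish almost everywhere, but []a, b[] minus a point has positive
    measure. The exceptional [x] will be the signal 1/2, where the two densities agree. *)
Lemma uint_gt0 (a b x : R) g : 0 <= a -> a < b -> b <= 1 ->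
  measurable_fun setT g -> (forall t, 0 <= g t) -> uintegrable g ->
  (forall t, a < t < b -> t != x -> 0 < g t) -> 0 < uint g.
Proof.
move=> a0 ab b1 mg g0 ig gpos; rewrite lt_def uint_ge0// andbT.
apply/negP => /eqP I0.
have : (\int[mu]_(t in D) `|(g t)%:E|)%E = 0%E.
  have -> : (\int[mu]_(t in D) `|(g t)%:E| = \int[mu]_(t in D) (g t)%:E)%E.
    by apply: eq_integral => t _; rewrite gee0_abs ?lee_fin.
  have := @integrable_fin_num _ _ R mu D (measurable_itv _) _ ig.
  by move/fineK => /= E; apply: etrans (esym E) _; congr EFin.
move/(@ae_eq_integral_abs _ _ R mu D (measurable_itv _) (EFin \o g)).
have mg' : measurable_fun D (EFin \o g) by exact/measurable_EFinP/measurable_funTS.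
move=> /(_ mg')[N [mN N0 subN]].
have : (mu `]a, b[ <= mu (N `|` [set x]))%E.
  apply: le_measure; rewrite ?inE//; first exact: measurableU.
  move=> t /=; rewrite in_itv/= => tab.
  have [->|tx] := eqVneq t x; [by right|left].
  apply: subN => /= Dg; have Dt : D t.
    by case/andP: tab => at_ tb; rewrite /= in_itv/= !ltW// ?(le_lt_trans a0)// (lt_le_trans tb).
  by case: (Dg Dt) => /eqP; rewrite gt_eqF// gpos.
rewrite leNgt => /negP; apply.
apply: (@le_lt_trans _ _ (mu N + mu [set x])%E).
  exact: (measureU2 mu mN (measurable_set1 x)).
have -> : mu N = 0%E by exact: N0.
rewrite lebesgue_measure_set1 adde0 lebesgue_measure_itv/= lte_fin ab.
by rewrite lte_fin subr_gt0.
Qed.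

Lemma measurable_inv : measurable_fun setT (@GRing.inv R).
Proof.
rewrite (_ : setT = ~` [set 0] `|` [set 0] :> set R); last by rewrite setUC setUv.
apply/measurable_funU; [exact: measurableC|by []|split].
  apply: open_continuous_measurable_fun; first exact/closed_openC/closed_eq.
  by move=> x /set_mem /eqP; exact: inv_continuous.
exact: measurable_fun_set1.
Qed.

(** Tonelli's theorem for the nonnegative [g], cut off outside the unit interval by an indicator. *)
Lemma measurable_uint d (T : measurableType d) (g : T * R -> R) :
  measurable_fun setT g -> (forall p, 0 <= g p) ->
  measurable_fun setT (fun z => uint (fun t => g (z, t))).
Proof.
move=> mg g0; apply: (measurableT_comp (@fine_measurable R setT measurableT)) => /=.
pose g' (p : T * R) : \bar R := ((g p) * \1_D p.2)%:E.
have := @measurable_fun_fubini_tonelli_F _ _ _ _ R mu g'.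
rewrite (_ : fubini_F _ _ = (fun z => \int[mu]_(t in D) (g (z, t))%:E)%E); last first.
  apply/funext => z; rewrite /fubini_F [RHS]integral_mkcond.
  apply: eq_integral => t _; rewrite /g' patchE /= indicE.
  by case: ifPn => _; rewrite ?mulr1 ?mulr0.
apply.
- apply/measurable_EFinP/measurable_funM => //.
  by apply: measurableT_comp => //.
- by move=> p; rewrite lee_fin mulr_ge0.
Qed.

End UnitIntegral.

(** * Iterated integrals over the cube, dominated by a product density *)

Section CubeIntegral.
Context {R : realType}.
Variable h : R -> R.
Hypothesis ih : uintegrable h.

Lemma prod_ge0 {m} (g : R -> R) (t : m.-tuple R) :
  (forall s, 0 <= g s) -> 0 <= \prod_(y <- t) g y.
Proof. by move=> g0; apply: prodr_ge0. Qed.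

Lemma measurable_tuple_prod {m} (g : R -> R) : measurable_fun setT g ->
  measurable_fun setT (fun t : m.-tuple R => \prod_(y <- t) g y).
Proof.
move=> mg; under eq_fun do rewrite big_tuple.
apply: measurable_prod => i _.
by apply: (measurableT_comp mg); exact: measurable_tnth.
Qed.

(** The parameter space [T] is arbitrary because the induction moves the first coordinate of the
    tuple into it. The bound is carried along since it makes the next outer integrand integrable. *)
Lemma measurable_cube_int m : forall d (T : measurableType d)
    (g : T * m.-tuple R -> R) (c : T -> R),
  measurable_fun setT g ->
  (forall z t, 0 <= g (z, t) <= c z * \prod_(y <- t) h y) ->
  measurable_fun setT (fun z => cube_int (fun t => g (z, t))) /\
  (forall z, 0 <= cube_int (fun t => g (z, t)) <= c z * uint h ^+ m).
Proof.
elim: m => [|m IH] d T g c mg gh.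
  split=> [|z]; last by have := gh z [tuple]; rewrite big_nil expr0.
  by apply: (measurableT_comp mg); exact: measurable_fun_pair.
pose g' (p : (T * R) * m.-tuple R) := g (p.1.1, [tuple of p.1.2 :: p.2]).
have mg' : measurable_fun setT g'.
  apply: (measurableT_comp mg); apply: measurable_fun_pair.
    by apply: (measurableT_comp measurable_fst).
  apply: measurable_cons => //.
  by apply: (measurableT_comp measurable_snd).
have gb' z t : 0 <= g' (z, t) <= c z.1 * h z.2 * \prod_(y <- t) h y.
  by rewrite /g' /= -mulrA; have := gh z.1 [tuple of z.2 :: t]; rewrite big_cons.
have [mG Gb] := IH _ _ g' (fun p => c p.1 * h p.2) mg' gb'.
have iG z : uintegrable (fun t => cube_int (fun u => g' ((z, t), u))).
  apply: (@uintegrable_dom _ (fun t => (c z * uint h ^+ m) * h t)).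
  - exact: uintegrableZ.
  - by apply: (measurableT_comp mG); exact: measurable_fun_pair.
  - move=> t; have /andP[G0 G1] := Gb (z, t).
    by rewrite ger0_norm// (le_trans G1)//= mulrAC.
split=> [|z].
  apply: (@measurable_uint _ _ _ (fun p : T * R => cube_int (fun u => g' (p, u)))) => //.
  by move=> p; case/andP: (Gb p).
rewrite cube_intS; apply/andP; split.
  by apply: uint_ge0 => t _; case/andP: (Gb (z, t)).
rewrite exprSr mulrA -uintZ//; apply: le_uint; [exact: (iG z)|exact: uintegrableZ|].
by move=> t _; have /andP[_ G1] := Gb (z, t); rewrite (le_trans G1)//= mulrAC.
Qed.

(** Domination by a multiple of the product of [h] is inherited when a coordinate is frozen, which
    keeps every layer of the iterated integral integrable. *)
Definition cube_dom {m} (g : m.-tuple R -> R) : Prop :=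
  measurable_fun setT g /\
  exists c, forall t, 0 <= g t <= c * \prod_(y <- t) h y.

Lemma measurable_tuple_cons {m} (t : R) :
  measurable_fun setT (fun u : m.-tuple R => [tuple of t :: u]).
Proof. by apply: measurable_cons. Qed.

Lemma cube_dom_cons {m} (g : m.+1.-tuple R -> R) (t : R) : cube_dom g ->
  cube_dom (fun u => g [tuple of t :: u]).
Proof.
move=> [mg [c gc]]; split; first exact: (measurableT_comp mg (measurable_tuple_cons t)).
exists (c * h t) => u.
by have := gc [tuple of t :: u]; rewrite big_cons mulrA.
Qed.

Lemma cube_dom_uintegrable {m} (g : m.+1.-tuple R -> R) : cube_dom g ->
  uintegrable (fun t => cube_int (fun u => g [tuple of t :: u])).
Proof.
move=> [mg [c gc]].
pose g' (p : R * m.-tuple R) := g [tuple of p.1 :: p.2].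
have mg' : measurable_fun setT g'.
  by apply: (measurableT_comp mg); exact: measurable_cons.
have gb' z t : 0 <= g' (z, t) <= c * h z * \prod_(y <- t) h y.
  by rewrite /g' /=; have := gc [tuple of z :: t]; rewrite big_cons mulrA.
have [mG Gb] := @measurable_cube_int m _ _ g' (fun p => c * h p) mg' gb'.
apply: (@uintegrable_dom _ (fun t => (c * uint h ^+ m) * h t)).
- exact: uintegrableZ.
- exact: mG.
- move=> t; have /andP[G0 G1] := Gb t.
  by rewrite ger0_norm// (le_trans G1)//= mulrAC.
Qed.

Lemma cube_domD {m} (g1 g2 : m.-tuple R -> R) : cube_dom g1 -> cube_dom g2 ->
  cube_dom (fun t => g1 t + g2 t).
Proof.
move=> [m1 [c1 b1]] [m2 [c2 b2]]; split; first exact: measurable_funD.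
exists (c1 + c2) => t; have /andP[? ?] := b1 t; have /andP[? ?] := b2 t.
by rewrite mulrDl lerD ?addr_ge0.
Qed.

Lemma cube_domZ {m} k (g : m.-tuple R -> R) : 0 <= k -> cube_dom g ->
  cube_dom (fun t => k * g t).
Proof.
move=> k0 [mg [c b]]; split; first exact: measurable_funM.
exists (k * c) => t; have /andP[? ?] := b t.
by rewrite mulr_ge0//= -mulrA ler_wpM2l.
Qed.

Lemma cube_intD {m} (g1 g2 : m.-tuple R -> R) : cube_dom g1 -> cube_dom g2 ->
  cube_int (fun t => g1 t + g2 t) = cube_int g1 + cube_int g2.
Proof.
elim: m g1 g2 => [//|m IH] g1 g2 d1 d2.
rewrite !cube_intS -uintD; try exact: cube_dom_uintegrable.
by apply: eq_uint => t _; rewrite IH//; exact: cube_dom_cons.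
Qed.

Lemma cube_intZ {m} k (g : m.-tuple R -> R) : cube_dom g ->
  cube_int (fun t => k * g t) = k * cube_int g.
Proof.
elim: m g => [//|m IH] g d.
rewrite !cube_intS -uintZ; last exact: cube_dom_uintegrable.
by apply: eq_uint => t _; rewrite IH//; exact: cube_dom_cons.
Qed.

Lemma le_cube_int {m} (g1 g2 : m.-tuple R -> R) : cube_dom g1 -> cube_dom g2 ->
  (forall t, (forall y, y \in val t -> 0 < y < 1) -> g1 t <= g2 t) ->
  cube_int g1 <= cube_int g2.
Proof.
elim: m g1 g2 => [|m IH] g1 g2 d1 d2 g12; first exact: g12.
rewrite !cube_intS; apply: le_uint; try exact: cube_dom_uintegrable.
move=> t t01; apply: IH; try exact: cube_dom_cons.
move=> u u01; apply: g12 => y /=.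
by rewrite inE => /predU1P[->//|/u01].
Qed.

Lemma eq_cube_int {m} (g1 g2 : m.-tuple R -> R) : cube_dom g1 -> cube_dom g2 ->
  (forall t, (forall y, y \in val t -> 0 < y < 1) -> g1 t = g2 t) ->
  cube_int g1 = cube_int g2.
Proof.
by move=> d1 d2 g12; apply/eqP; rewrite eq_le !le_cube_int// => t /g12 ->.
Qed.

Lemma cube_dom_prod {m} (g : R -> R) : measurable_fun setT g ->
  (forall s, 0 <= g s <= h s) -> cube_dom (fun t : m.-tuple R => \prod_(y <- t) g y).
Proof.
move=> mg gh; split; first exact: measurable_tuple_prod.
exists 1 => t; rewrite mul1r; apply/andP; split.
  by apply: prod_ge0 => s; case/andP: (gh s).
exact: ler_prod.
Qed.

Lemma cube_dom_le {m} (g1 g2 : m.-tuple R -> R) : measurable_fun setT g1 ->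
  (forall t, 0 <= g1 t <= g2 t) -> cube_dom g2 -> cube_dom g1.
Proof.
move=> mg1 g12 [mg2 [c b]]; split=> //; exists c => t.
have /andP[-> g12t] := g12 t; case/andP: (b t) => _; exact: le_trans.
Qed.

Lemma cube_int_ge0 {m} (g : m.-tuple R -> R) : (forall t, 0 <= g t) -> 0 <= cube_int g.
Proof.
elim: m g => [|m IH] g g0; first exact: g0.
by rewrite cube_intS; apply: uint_ge0 => t _; exact: IH.
Qed.

Lemma cube_int_prod {m} (g : R -> R) : uintegrable g ->
  cube_int (fun t : m.-tuple R => \prod_(y <- t) g y) = uint g ^+ m.
Proof.
(* The induction carries a factor [k], which absorbs the coordinates already read. *)
move=> ig; suff H k : cube_int (fun t : m.-tuple R => k * \prod_(y <- t) g y) = k * uint g ^+ m.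
  by rewrite -[RHS]mul1r -H; congr cube_int; apply/funext => t; rewrite mul1r.
elim: m k => [|m IH] k; first by rewrite /= big_nil.
rewrite cube_intS (@eq_uint _ _ (fun t => (k * uint g ^+ m) * g t)).
  by rewrite uintZ// exprSr mulrA.
move=> t _; rewrite -[RHS]mulrAC -IH; congr cube_int; apply/funext => u.
by rewrite big_cons mulrA.
Qed.

End CubeIntegral.

(** * The gain of a single option *)

Definition unit_density {R : realType} (f : R -> R) : Prop :=
  [/\ measurable_fun setT f, forall s, 0 <= f s,
      forall s, ~ (0 <= s <= 1) -> f s = 0, uintegrable f & uint f = 1].

Section Gain.
Context {R : realType} {f : R -> R}.
Hypothesis df : unit_density f.
Let mf : measurable_fun setT f. Proof. by case: df. Qed.
Let f0 : forall s, 0 <= f s. Proof. by case: df. Qed.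
Let fout : forall s, ~ (0 <= s <= 1) -> f s = 0. Proof. by case: df. Qed.
Let if_ : uintegrable f. Proof. by case: df. Qed.
Let f1 : uint f = 1. Proof. by case: df. Qed.

(** Ties count as acceptance. The test looks at the sign of the value [s p - (1 - s) q], whereas the
    amount [s p + (1 - s) q] is the probability of being served. *)
Definition accept (p q s : R) : R :=
  if (1 - s) * q <= s * p then s * p + (1 - s) * q else 0.

Definition gain (p q : R) : R := uint (fun s => f s * accept p q s).

Lemma uintegrableM (g : R -> R) : measurable_fun setT g ->
  (exists c, forall s, 0 <= s <= 1 -> `|g s| <= c) -> uintegrable (fun s => f s * g s).
Proof.
move=> mg [c gc]; apply: (@uintegrable_dom _ (fun s => c * f s)).
- exact: uintegrableZ.
- exact: measurable_funM.
- move=> s; rewrite normrM (ger0_norm (f0 s)) mulrC.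
  have [/gc sc|s01] := boolP (0 <= s <= 1); first exact: ler_wpM2r.
  by rewrite fout ?mulr0//; apply/negP.
Qed.

Lemma measurable_affine (p q : R) :
  measurable_fun setT (fun s : R => s * p + (1 - s) * q).
Proof.
by apply: measurable_funD; apply: measurable_funM => //; exact: measurable_funB.
Qed.

Lemma measurable_accept p q : measurable_fun setT (accept p q).
Proof.
apply: measurable_fun_ifT => //; last exact: measurable_affine.
by apply: measurable_fun_ler; apply: measurable_funM => //; exact: measurable_funB.
Qed.

Lemma accept_ge0 p q s : 0 <= p -> 0 <= q -> 0 <= s <= 1 -> 0 <= accept p q s.
Proof. by move=> p0 q0 s01; rewrite /accept; case: ifP => // _; nra. Qed.

Lemma accept_le p q s : 0 <= p -> 0 <= q -> 0 <= s <= 1 ->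
  accept p q s <= s * p + (1 - s) * q.
Proof. by move=> p0 q0 s01; rewrite /accept; case: ifP => // _; nra. Qed.

Lemma uintegrable_gain p q : 0 <= p -> 0 <= q ->
  uintegrable (fun s => f s * accept p q s).
Proof.
move=> p0 q0; apply: uintegrableM; first exact: measurable_accept.
exists (p + q) => s s01; rewrite ger0_norm ?accept_ge0//.
by rewrite (le_trans (accept_le p0 q0 s01))//; nra.
Qed.

Lemma gain_ge0 p q : 0 <= p -> 0 <= q -> 0 <= gain p q.
Proof. by move=> p0 q0; apply: uint_ge0 => s s01; rewrite mulr_ge0// accept_ge0. Qed.

Lemma gain_le p q : 0 <= p -> 0 <= q -> gain p q <= p + q.
Proof.
move=> p0 q0; rewrite -[leRHS]mulr1 -f1 -uintZ//.
apply: le_uint; [exact: uintegrable_gain|exact: uintegrableZ|].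
move=> s /andP[/ltW s0 /ltW s1]; rewrite mulrC ler_wpM2r//.
by rewrite (le_trans (accept_le p0 q0 _)) ?s0//; nra.
Qed.

(** Scaling an option by [k > 0] leaves its set of accepting types unchanged; for [k = 0] both sides
    vanish. *)
Lemma gainZ k p q : 0 <= k -> 0 <= p -> 0 <= q ->
  gain (k * p) (k * q) = k * gain p q.
Proof.
move=> k0 p0 q0; rewrite /gain -uintZ; last exact: uintegrable_gain.
apply: eq_uint => s _; rewrite /accept mulrCA [k * (f s * _)]mulrCA; congr (_ * _).
move: k0; rewrite le_eqVlt => /predU1P[<-|k0].
  by rewrite !mul0r !mulr0 lexx addr0.
rewrite ![_ * (k * _)]mulrCA ler_pM2l//.
by case: ifP => _; rewrite ?mulr0// mulrDr.
Qed.

(* The types accepting [(1 - p, 1 - q)] over [(0, 0)] accept [(p, q)] as well,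
   unless [(1 - p, 1 - q)] is worthless. *)
Lemma gain_add e p q : 0 <= q -> q <= p -> p <= 1 -> 0 <= e ->
  gain (1 - p) (1 - q) <= gain (1 - p + e * p) (1 - q + e * q).
Proof.
move=> q0 qp p1 e0.
have ? : 0 <= 1 - p + e * p by nra.
have ? : 0 <= 1 - q + e * q by nra.
apply: le_uint; [apply: uintegrable_gain; lra|exact: uintegrable_gain|].
move=> s /andP[s0 s1]; apply: ler_wpM2l => //.
rewrite {1}/accept; case: ifP => [a|_]; last by apply: accept_ge0 => //; lra.
have [q1|q1] := ltP q 1; last first.
  have -> : q = 1 by lra.
  have -> : p = 1 by lra.
  by rewrite !subrr !mulr0 addr0; apply: accept_ge0; lra.
(* Since [1 - p <= 1 - q] and [q < 1], accepting the upgrade forces [1 - s <= s]; then [q <= p]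
   makes [s] accept [(p, q)] too. *)
have s12 : 1 - s <= s by have [?|?] := ltP p 1; nra.
have a' : (1 - s) * q <= s * p by nra.
rewrite /accept ifT; last by nra.
have : 0 <= e * (s * p + (1 - s) * q) by apply: mulr_ge0 => //; nra.
by nra.
Qed.

(** A type that rejects [(p, e)] has [s * p < (1 - s) * e <= e], so little is lost by moving off the
    boundary [q = 0]. *)
Lemma gain_p0 e p : 0 <= p -> 0 <= e -> gain p 0 <= gain p e + e.
Proof.
move=> p0 e0; rewrite -[X in _ + X]mulr1 -f1 -uintZ// -uintD; last 2 first.
  exact: uintegrable_gain.
  exact: uintegrableZ.
apply: le_uint; [exact: uintegrable_gain| |].
  by apply: uintegrableD; [exact: uintegrable_gain|exact: uintegrableZ].
move=> s /andP[s0 s1]; rewrite [e * _]mulrC -mulrDr ler_wpM2l//.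
rewrite /accept mulr0 mulr_ge0 ?(ltW s0)// addr0.
by case: ifPn => [_|]; [nra|rewrite -ltNge; nra].
Qed.

(** Lowering the second coordinate from 1 to [1 - e] deters nobody and costs each accepting type
    only [(1 - s) * e]. *)
Lemma gain_1p e p : 0 <= p -> 0 <= e <= 1 -> gain p 1 <= gain p (1 - e) + e.
Proof.
move=> p0 /andP[e0 e1]; have e1' : 0 <= 1 - e by lra.
apply: (@le_trans _ _ (uint (fun s => f s * accept p (1 - e) s + e * f s))); last first.
  by rewrite uintD ?uintZ ?f1 ?mulr1//; [exact: uintegrable_gain|exact: uintegrableZ].
apply: le_uint; [exact: uintegrable_gain| |].
  by apply: uintegrableD; [exact: uintegrable_gain|exact: uintegrableZ].
move=> s /andP[s0 s1]; rewrite [e * _]mulrC -mulrDr ler_wpM2l//.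
rewrite /accept; case: ifPn => [a|_]; last by case: ifPn => [_|_]; nra.
by rewrite ifT; nra.
Qed.

(** * One-dimensional separation for the gain *)

Section Duality.
Variable W : R.
Hypothesis Wub : forall p q, 0 < q -> q <= p -> p <= 1 ->
  gain p q + gain (1 - p) (1 - q) <= W.

(** Extends [Wub] to [q = 0]: for [p = 0] the two options are those of the pair [(1, 1)] in the
    other order, and for [p > 0] the coordinate 0 is replaced by a small [d]. *)
Lemma gain_pair_ub p q : 0 <= q -> q <= p -> p <= 1 ->
  gain p q + gain (1 - p) (1 - q) <= W.
Proof.
rewrite le_eqVlt => /predU1P[<-|]; last exact: Wub.
rewrite le_eqVlt => /predU1P[<- _|p0 p1].
  rewrite subr0 addrC; have := Wub ltr01 (lexx _) (lexx _).
  by rewrite subrr.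
rewrite subr0; apply/ler_addgt0Pr => e e0.
(* Raising [q] from 0 to [d] costs [d] in each of the two gains, so [e / 2] keeps the total within
   [e]; [d <= p] keeps [Wub] applicable. *)
pose d := Num.min p (e / 2).
have d0 : 0 < d by rewrite lt_min p0/=; lra.
have dp : d <= p by rewrite ge_min lexx.
have de : d <= e / 2 by rewrite ge_min lexx orbT.
have := Wub d0 dp p1.
have := gain_p0 (ltW p0) (ltW d0).
have p1' : 0 <= 1 - p by lra.
have d01 : 0 <= d <= 1 by apply/andP; split; lra.
have := gain_1p p1' d01.
by lra.
Qed.

(** The two options lie on opposite sides of the diagonal, so positive multiples of them sum to
    [(1, 1)]; the pair bound and homogeneity then apply. *)
Lemma gain_two_point p q p' q' : 0 <= q -> q < p -> 0 <= p' -> p' < q' ->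
  (q' - p') * gain p q + (p - q) * gain p' q' <= (p * q' - p' * q) * W.
Proof.
move=> q0 qp p0 pq'.
(* Cramer's rule for [k (p, q) + k' (p', q') = (1, 1)], with determinant [c]. *)
pose c := p * q' - p' * q.
have c0 : 0 < c by rewrite /c; nra.
pose k := (q' - p') / c; pose k' := (p - q) / c.
have k0 : 0 <= k by rewrite divr_ge0//; lra.
have k0' : 0 <= k' by rewrite divr_ge0//; lra.
have cN0 : c != 0 by rewrite gt_eqF.
have e1 : k * p = 1 - k' * p'.
  by rewrite /k /k' /c; field.
have e2 : k * q = 1 - k' * q'.
  by rewrite /k /k' /c; field.
have kq : 0 <= k * q by apply: mulr_ge0.
have kp' : 0 <= k' * p' by apply: mulr_ge0.
have kqp : k * q <= k * p by apply: ler_wpM2l => //; lra.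
have kp1 : k * p <= 1 by lra.
have := gain_pair_ub kq kqp kp1.
have -> : 1 - k * p = k' * p' by lra.
have -> : 1 - k * q = k' * q' by lra.
rewrite !gainZ//; [|lra..].
move=> /(ler_wpM2l (ltW c0)).
have <- : c * k = q' - p' by rewrite mulrC divfK.
have <- : c * k' = p - q by rewrite mulrC divfK.
by rewrite -/c; lra.
Qed.

(** Write [l1 = W / 2 - d] and [l2 = W / 2 + d]. Options with [p < q] bound [d] from below, those
    with [q < p] from above, and by [gain_two_point] no lower bound exceeds an upper one; [d] is the
    supremum of the lower bounds. On the diagonal, homogeneity reduces the claim to
    [gain 1 1 <= W]. *)
Lemma gain_dual : exists l1 l2 : R, [/\ 0 <= l1, 0 <= l2, l1 + l2 = W &
  forall p q, 0 <= p -> 0 <= q -> gain p q <= l1 * p + l2 * q].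
Proof.
pose S := [set d | exists p' q', [/\ 0 <= p', p' < q' &
  d = (gain p' q' - W / 2 * (p' + q')) / (q' - p')]].
have Sub p q : 0 <= q -> q < p -> ubound S ((W / 2 * (p + q) - gain p q) / (p - q)).
  move=> q0 qp _ [p' [q' [p0 pq' ->]]].
  rewrite ler_pdivrMr ?subr_gt0// [leRHS]mulrAC ler_pdivlMr ?subr_gt0//.
  by have := gain_two_point q0 qp p0 pq'; nra.
have S01 : S ((gain 0 1 - W / 2 * (0 + 1)) / (1 - 0)).
  by exists 0, 1; split => //; exact: ltr01.
have S10 := Sub 1 0 (lexx _) ltr01.
have main p q : 0 <= p -> 0 <= q ->
    gain p q <= (W / 2 - sup S) * p + (W / 2 + sup S) * q.
  move=> p0 q0; have [qp|pq|->] := ltgtP q p.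
  - have : sup S <= (W / 2 * (p + q) - gain p q) / (p - q).
      by apply: ge_sup; [exists ((gain 0 1 - W / 2 * (0 + 1)) / (1 - 0))|exact: Sub].
    by rewrite ler_pdivlMr ?subr_gt0//; nra.
  - have : (gain p q - W / 2 * (p + q)) / (q - p) <= sup S.
      apply: ub_le_sup; first by eexists; exact: S10.
      by exists p, q.
    by rewrite ler_pdivrMr ?subr_gt0//; nra.
  - have := gain_pair_ub ler01 (lexx _) (lexx _).
    rewrite subrr => g11; have := gain_ge0 (lexx _) (lexx _).
    have := gainZ p0 ler01 ler01; rewrite mulr1 => -> ?.
    have : p * gain 1 1 <= p * W by apply: ler_wpM2l => //; lra.
    by lra.
exists (W / 2 - sup S), (W / 2 + sup S); split=> //.
- have := main 1 0 ler01 (lexx _); have := gain_ge0 ler01 (lexx _); lra.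
- have := main 0 1 (lexx _) ler01; have := gain_ge0 (lexx _) ler01; lra.
- by field.
Qed.

End Duality.
End Gain.
Arguments gain {R} f p q.

(** * Upper bound on the service given by an incentive compatible menu [s |-> (P s, Q s)] *)

Section Screening.
Context {R : realType} {f : R -> R}.
Hypothesis df : unit_density f.
Let mf : measurable_fun setT f. Proof. by case: df. Qed.
Let f0 : forall s, 0 <= f s. Proof. by case: df. Qed.
Let fout : forall s, ~ (0 <= s <= 1) -> f s = 0. Proof. by case: df. Qed.
Let if_ : uintegrable f. Proof. by case: df. Qed.
Let f1 : uint f = 1. Proof. by case: df. Qed.

Variables a b : R.
Hypothesis fab : forall s, 0 < f s -> a <= s <= b.
Hypothesis abf : forall s, a < s < b -> 0 < f s.

Variables P Q : R -> R.
Hypothesis mP : measurable_fun setT P.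
Hypothesis mQ : measurable_fun setT Q.
Hypothesis P01 : forall s, 0 <= P s <= 1.
Hypothesis Q01 : forall s, 0 <= Q s <= 1.
Hypothesis part : forall s, 0 < f s -> 0 <= s * P s - (1 - s) * Q s.
Hypothesis incent : forall s r, 0 < f s -> 0 < f r ->
  s * P r - (1 - s) * Q r <= s * P s - (1 - s) * Q s.

Let type01 s : 0 < f s -> 0 <= s <= 1.
Proof. by move=> fs; apply: contraPT fs => /negP/fout ->; rewrite ltxx. Qed.

(** With [x] and [y] the increments, the two incentive constraints give [s (1 - r) x <= (1 - s) (1 -
    r) y <= r (1 - s) x], that is [(r - s) x >= 0]; eliminating [x] instead treats [y]. *)
Lemma menu_nondecreasing s r : 0 < f s -> 0 < f r -> s <= r ->
  P s <= P r /\ Q s <= Q r.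
Proof.
move=> fs fr; rewrite le_eqVlt => /predU1P[->//|sr].
have := incent fs fr; have := incent fr fs.
have := type01 fs; have := type01 fr => /andP[r0 r1] /andP[s0 s1] i1 i2.
set x := P r - P s; set y := Q r - Q s.
have h1 : (1 - r) * y <= r * x by rewrite /x /y; lra.
have h2 : s * x <= (1 - s) * y by rewrite /x /y; lra.
split.
- have : 0 <= (r - s) * x by nra.
  by rewrite pmulr_rge0 ?subr_gt0// subr_ge0.
- have : 0 <= (r - s) * y by nra.
  by rewrite pmulr_rge0 ?subr_gt0// subr_ge0.
Qed.

Let tl (c s : R) : R := if c <= s then 1 else 0.

Let mtl c : measurable_fun setT (tl c).
Proof. by apply: measurable_fun_ifT => //; exact: measurable_fun_ler. Qed.

Let tl01 c s : 0 <= tl c s <= 1.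
Proof. by rewrite /tl; case: ifP => _; rewrite ?lexx ler01. Qed.

Definition tail_mass c : R := uint (fun s => f s * tl c s).

Let itl c : uintegrable (fun s => f s * tl c s).
Proof.
apply: uintegrableM => //; exists 1 => s _.
by have /andP[? ?] := tl01 c s; rewrite ger0_norm.
Qed.

Lemma tail_mass_continuous : continuous tail_mass.
Proof.
apply: (@continuous_tail _ f id) => // c; exists c => t _.
by [].
Qed.

(** Together with [tail_mass_lta] this places every cutoff whose tail mass lies strictly between 0
    and 1 inside []a, b[], where cutoffs are themselves types. *)
Lemma tail_mass_gtb c : 0 < tail_mass c -> c < b.
Proof.
apply: contraPT; rewrite -leNgt => bc.
suff -> : tail_mass c = 0 by rewrite ltxx.
transitivity (uint (fun=> 0 : R)); last by rewrite /uint Rintegral_cst// mul0r.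
apply: (@eq_uint_off1 _ b) => //; first exact: measurable_funM.
move=> s sb; rewrite /tl; case: ifPn => cs; rewrite ?mulr0// mulr1.
apply: contrapT => /eqP fs; have : 0 < f s by rewrite lt_def fs f0.
move/fab => /andP[_ sb']; move/eqP: sb; apply.
by apply/eqP; rewrite eq_le sb' (le_trans bc).
Qed.

Lemma tail_mass_lta c : tail_mass c < 1 -> a < c.
Proof.
apply: contraPT; rewrite -leNgt => ca.
suff -> : tail_mass c = uint f by rewrite f1 ltxx.
congr uint; apply/funext => s; rewrite /tl; case: ifPn => cs; rewrite ?mulr1 ?mulr0//.
apply/esym; apply: contrapT => /eqP fs; have : 0 < f s by rewrite lt_def fs f0.
by move/fab => /andP[as_ _]; rewrite (le_trans ca) in cs.
Qed.

Lemma tail_mass_quantile c m : 0 < m < tail_mass c -> c < b ->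
  exists2 c', c <= c' & tail_mass c' = m.
Proof.
move=> /andP[m0 mc] cb.
have tb : tail_mass b = 0.
  apply/eqP; rewrite eq_le leNgt; apply/andP; split.
    by apply/negP => /tail_mass_gtb; rewrite ltxx.
  by apply: uint_ge0 => s _; rewrite mulr_ge0//; case/andP: (tl01 b s).
have cont : {within `[c, b], continuous tail_mass}.
  by apply: continuous_subspaceT => x; exact: tail_mass_continuous.
have := @IVT R tail_mass c b m (ltW cb) cont.
rewrite tb ge_min le_max (ltW mc) (ltW m0) /= orbT => /(_ isT)[c' c'cb c'm].
by exists c' => //; move: c'cb; rewrite in_itv/= => /andP[].
Qed.

Lemma tail_mass0 : tail_mass 0 = 1.
Proof.
rewrite -f1; apply: eq_uint => s /andP[s0 _].
by rewrite /tl s0 mulr1.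
Qed.

(** Expected service that the types from [c] upward receive beyond the option of [c]; the
    telescoping runs on this quantity. *)
Let surplus c : R :=
  uint (fun s => f s * (tl c s * (s * (P s - P c) + (1 - s) * (Q s - Q c)))).

Let dPQ_le1 (s c : R) : `|P s - P c| <= 1 /\ `|Q s - Q c| <= 1.
Proof.
have := P01 s; have := P01 c; have := Q01 s; have := Q01 c.
by move=> /andP[? ?] /andP[? ?] /andP[? ?] /andP[? ?]; rewrite !ler_norml; split; lra.
Qed.

Let isurplus c :
  uintegrable (fun s => f s * (tl c s * (s * (P s - P c) + (1 - s) * (Q s - Q c)))).
Proof.
apply: uintegrableM => //.
  apply: measurable_funM => //; apply: measurable_funD; apply: measurable_funM => //;
    exact: measurable_funB.
exists 2 => s /andP[s0 s1]; have [p1 q1] := dPQ_le1 s c.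
have /andP[t0 t1] := tl01 c s; rewrite normrM (ger0_norm t0).
rewrite (@le_trans _ _ (1 * `|s * (P s - P c) + (1 - s) * (Q s - Q c)|))//.
  exact: ler_wpM2r.
rewrite mul1r (le_trans (ler_normD _ _))// !normrM (ger0_norm s0).
have s1' : 0 <= 1 - s by rewrite subr_ge0.
rewrite (ger0_norm s1').
by have := ler_wpM2l s0 p1; have := ler_wpM2l s1' q1; lra.
Qed.

Variables l1 l2 : R.
Hypothesis l1_ge0 : 0 <= l1.
Hypothesis l2_ge0 : 0 <= l2.
Hypothesis gain_ub : forall p q, 0 <= p -> 0 <= q -> gain f p q <= l1 * p + l2 * q.

(** Induction on the number of cells of mass [e] above [c]. The slack [e] sits next to [l1] and
    [l2], so that it telescopes together with the main terms. *)
Lemma surplus_ub e k c : 0 < e -> a < c < b -> tail_mass c <= k.+1%:R * e ->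
  surplus c <= (l1 + e) * (1 - P c) + (l2 + e) * (1 - Q c).
Proof.
move=> e0; elim: k c => [|k IH] c acb.
  rewrite mul1r => mce; have /andP[? ?] := P01 c; have /andP[? ?] := Q01 c.
  apply: (@le_trans _ _ (uint (fun s => ((1 - P c) + (1 - Q c)) * (f s * tl c s)))).
    apply: le_uint; [exact: isurplus|exact: uintegrableZ|].
    move=> s /andP[s0 s1]; rewrite mulrA [leRHS]mulrC; apply: ler_wpM2l.
      by rewrite mulr_ge0//; case/andP: (tl01 c s).
    by have /andP[? ?] := P01 s; have /andP[? ?] := Q01 s; nra.
  rewrite uintZ//.
  have : (1 - P c + (1 - Q c)) * tail_mass c <= (1 - P c + (1 - Q c)) * e.
    by apply: ler_wpM2l => //; lra.
  rewrite -/(tail_mass c).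
  have : 0 <= l1 * (1 - P c) by apply: mulr_ge0 => //; lra.
  have : 0 <= l2 * (1 - Q c) by apply: mulr_ge0 => //; lra.
  by lra.
move=> mc; have [|mck] := leP (tail_mass c) (k.+1%:R * e); first exact: IH.
have ke0 : 0 < k.+1%:R * e by rewrite mulr_gt0.
have mM : 0 < k.+1%:R * e < tail_mass c by rewrite ke0.
(* The cut leaves exactly [k.+1] cells of mass above [c'], so the types from [c] to [c'] have mass
   at most [e]. *)
have [|c' cc' mc'] := tail_mass_quantile mM; first by case/andP: acb.
have c'b : c' < b by apply: tail_mass_gtb; rewrite mc'.
have ac'b : a < c' < b by rewrite c'b andbT (lt_le_trans _ cc')//; case/andP: acb.
have fc := abf acb; have fc' := abf ac'b.
have [dP dQ] := menu_nondecreasing fc fc' cc'.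
have {}IH : surplus c' <= (l1 + e) * (1 - P c') + (l2 + e) * (1 - Q c').
  by apply: IH => //; rewrite mc'.
set dp := P c' - P c; set dq := Q c' - Q c.
have dp0 : 0 <= dp by rewrite subr_ge0.
have dq0 : 0 <= dq by rewrite subr_ge0.
(* Type [c'] does not envy [c], so it accepts the increment [(dp, dq)], and so do all higher
   types. *)
have dpq : (1 - c') * dq <= c' * dp.
  by have := incent fc' fc; rewrite /dp /dq; lra.
have := gain_ub dp0 dq0.
(* Above [c'] the increment is part of [gain f dp dq]; between [c] and [c'] monotonicity caps the
   excess over the option of [c] by [dp + dq]. *)
have split_le : surplus c <= (dp + dq) * (tail_mass c - tail_mass c') + surplus c' + gain f dp dq.
  have iB : uintegrable (fun s => f s * tl c s + - 1 * (f s * tl c' s)).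
    by apply: uintegrableD => //; exact: uintegrableZ.
  have -> : tail_mass c - tail_mass c' = uint (fun s => f s * tl c s + - 1 * (f s * tl c' s)).
    by rewrite uintD// ?uintZ ?mulN1r//; exact: uintegrableZ.
  have ig := uintegrable_gain df dp0 dq0.
  have i1 := uintegrableZ (dp + dq) iB; have i2 := uintegrableD i1 (isurplus c').
  rewrite -(uintZ _ iB) -(uintD i1 (isurplus c')) -(uintD i2 ig).
  apply: le_uint; [exact: isurplus|exact: uintegrableD|].
  move=> s /andP[s0 s1].
  rewrite (_ : (dp + dq) * _ + _ + _ = f s * ((dp + dq) * (tl c s - tl c' s) +
     tl c' s * (s * (P s - P c') + (1 - s) * (Q s - Q c')) + accept dp dq s)); last by ring.
  have := f0 s; rewrite le_eqVlt => /predU1P[<-|fs]; first by rewrite !mul0r.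
  rewrite ler_pM2l//.
  have acc0 : 0 <= accept dp dq s by apply: accept_ge0 => //; rewrite (ltW s0) (ltW s1).
  rewrite /tl; have [c's|sc'] := leP c' s.
    rewrite (le_trans cc' c's) subrr mulr0 add0r !mul1r /accept ifT; last by nra.
    by rewrite /dp /dq; lra.
  rewrite subr0 mul0r addr0; case: ifP => cs; last by rewrite mul0r mulr0 add0r.
  rewrite mul1r mulr1; have [? ?] := menu_nondecreasing fs fc' (ltW sc').
  by rewrite /dp /dq in acc0 *; nra.
have : (dp + dq) * (tail_mass c - tail_mass c') <= (dp + dq) * e.
  apply: ler_wpM2l; first by rewrite addr_ge0.
  by rewrite mc'; move: mc; rewrite -natr1; lra.
by rewrite /dp /dq in split_le *; lra.
Qed.

(** Take a low cutoff [c] with tail mass [1 - e]. By participation the option of [c] is accepted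
    from [c] upward, so it contributes at most its gain there; [surplus_ub] covers what higher types
    get beyond it, and the types below [c] have small mass. *)
Lemma screening_ub : uint (fun s => f s * (s * P s + (1 - s) * Q s)) <= l1 + l2.
Proof.
apply/ler_addgt0Pr => e' e'0.
(* Types below [c] contribute at most [2 * e] and the slack of [surplus_ub] at most another [2 * e],
   whence the 4; [e <= 1 / 2] keeps the tail mass [1 - e] positive. *)
pose e := Num.min (1 / 2) (e' / 4).
have e0 : 0 < e by rewrite lt_min; apply/andP; split; lra.
have e1 : e <= 1 / 2 by rewrite ge_min lexx.
have ee' : e <= e' / 4 by rewrite ge_min lexx orbT.
have [|b0] := ltP 0 b; last first.
  suff : tail_mass 0 = 0 by rewrite tail_mass0 => /eqP; rewrite oner_eq0.
  by apply/eqP; rewrite eq_le leNgt uint_ge0 ?andbT => [|s _]; [apply/negP => /tail_mass_gtb; rewrite ltNge b0|rewrite mulr_ge0//; case/andP: (tl01 0 s)].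
move=> b0; have mM : 0 < 1 - e < tail_mass 0 by rewrite tail_mass0; apply/andP; split; lra.
have [c c0 mc] := tail_mass_quantile mM b0.
have acb : a < c < b.
  by rewrite tail_mass_lta ?tail_mass_gtb// mc; lra.
have fc := abf acb.
have /andP[Pc0 Pc1] := P01 c; have /andP[Qc0 Qc1] := Q01 c.
have [k ke] : exists k, tail_mass c <= k.+1%:R * e.
  exists (Num.bound (1 / e)).
  have := archi_boundP (divr_ge0 ler01 (ltW e0)).
  by rewrite ltr_pdivrMr// mc -natr1 mulrDl; lra.
have sub := surplus_ub e0 acb ke.
have := gain_ub Pc0 Qc0.
have : uint (fun s => f s * (s * P s + (1 - s) * Q s)) <=
    (P c + Q c) * (1 - tail_mass c) + surplus c + gain f (P c) (Q c).
  have iB : uintegrable (fun s => f s + - 1 * (f s * tl c s)).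
    by apply: uintegrableD => //; exact: uintegrableZ.
  have -> : 1 - tail_mass c = uint (fun s => f s + - 1 * (f s * tl c s)).
    by rewrite uintD// ?uintZ ?mulN1r ?f1//; exact: uintegrableZ.
  have ig := uintegrable_gain df Pc0 Qc0.
  have i1 := uintegrableZ (P c + Q c) iB; have i2 := uintegrableD i1 (isurplus c).
  rewrite -(uintZ _ iB) -(uintD i1 (isurplus c)) -(uintD i2 ig).
  apply: le_uint.
  - apply: uintegrableM => //.
      by apply: measurable_funD; apply: measurable_funM => //; exact: measurable_funB.
    exists 1 => s /andP[s0 s1]; have /andP[? ?] := P01 s; have /andP[? ?] := Q01 s.
    by rewrite ger0_norm; nra.
  - exact: uintegrableD.
  move=> s /andP[s0 s1].
  rewrite (_ : (P c + Q c) * _ + _ + _ = f s * ((P c + Q c) * (1 - tl c s) +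
     tl c s * (s * (P s - P c) + (1 - s) * (Q s - Q c)) + accept (P c) (Q c) s)); last by ring.
  have := f0 s; rewrite le_eqVlt => /predU1P[<-|fs]; first by rewrite !mul0r.
  rewrite ler_pM2l//.
  have acc0 : 0 <= accept (P c) (Q c) s by apply: accept_ge0 => //; rewrite (ltW s0) (ltW s1).
  rewrite /tl; have [cs|sc] := leP c s.
    have := part fc; rewrite subrr mulr0 add0r !mul1r /accept => pc.
    by rewrite ifT; nra.
  rewrite subr0 mul0r addr0 mulr1; have [? ?] := menu_nondecreasing fs fc (ltW sc).
  have /andP[? ?] := P01 s; have /andP[? ?] := Q01 s.
  by nra.
have : (P c + Q c) * (1 - tail_mass c) <= 2 * e.
  have -> : 1 - tail_mass c = e by rewrite mc; lra.
  by apply: ler_wpM2r; lra.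
by have : (2 - P c - Q c) * e <= 2 * e; [apply: ler_wpM2r; lra|lra].
Qed.

End Screening.

(** * Interim service probabilities of a mechanism *)

Section Interim.
Context {R : realType} {h phi : R -> R} {m : nat}.
Hypothesis ih : uintegrable h.
Hypothesis mphi : measurable_fun setT phi.
Hypothesis phih : forall s, 0 <= phi s <= h s.
Hypothesis iphi : uintegrable phi.
Hypothesis uphi : uint phi = 1.

Let phi0 s : 0 <= phi s.
Proof. by case/andP: (phih s). Qed.

(** For [phi] equal to [fp] or [fm] these are the two coordinates of the option that report [r]
    gives. *)
Definition interim (x : R * m.-tuple R -> R) (r : R) : R :=
  cube_int (fun t => x (r, t) * \prod_(y <- t) phi y).

Variable x : R * m.-tuple R -> R.
Hypothesis mx : measurable_fun setT x.
Hypothesis x01 : forall p, 0 <= x p <= 1.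

Lemma cube_dom_interim r :
  cube_dom h (fun t => x (r, t) * \prod_(y <- t) phi y).
Proof.
apply: (cube_dom_le (g2 := fun t => \prod_(y <- t) phi y)).
- apply: measurable_funM; last exact: measurable_tuple_prod.
  by apply: (measurableT_comp mx); exact: measurable_fun_pair.
- move=> t; have /andP[? ?] := x01 (r, t).
  by rewrite mulr_ge0 ?prod_ge0//= ler_piMl ?prod_ge0.
- exact: cube_dom_prod.
Qed.

Lemma interim01 r : 0 <= interim x r <= 1.
Proof.
apply/andP; split.
  apply: cube_int_ge0 => t; rewrite mulr_ge0 ?prod_ge0//.
  by case/andP: (x01 (r, t)).
rewrite -(expr1n R m) -uphi -cube_int_prod//.
apply: (le_cube_int (h := h)) => //.
- exact: cube_dom_interim.
- exact: cube_dom_prod.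
- move=> t _; have /andP[? ?] := x01 (r, t).
  by rewrite ler_piMl ?prod_ge0.
Qed.

Lemma measurable_interim : measurable_fun setT (interim x).
Proof.
pose g (p : R * m.-tuple R) := x p * \prod_(y <- p.2) phi y.
have mg : measurable_fun setT g.
  apply: measurable_funM => //.
  by apply: (measurableT_comp (measurable_tuple_prod mphi)).
have gh z t : 0 <= g (z, t) <= (fun=> 1) z * \prod_(y <- t) h y.
  have /andP[? ?] := x01 (z, t); rewrite mulr_ge0 ?prod_ge0//= mul1r /g/=.
  by rewrite (@le_trans _ _ (\prod_(y <- t) phi y)) ?ler_piMl ?prod_ge0// ler_prod.
by have [] := measurable_cube_int ih mg gh.
Qed.

End Interim.
Arguments interim {R} phi {m} x r.

(** * From the market model to menus of options *)

Section Model.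
Context {R : realType} {fm fp : R -> R}.
Hypothesis ma : model_assumptions fm fp.

Let f := fmix fm fp.

Lemma density_measurable : measurable_fun setT fm /\ measurable_fun setT fp.
Proof. by case: ma => ? [? _]. Qed.

Lemma density_le s : (0 <= fm s <= fm s + fp s) /\ (0 <= fp s <= fm s + fp s).
Proof.
case: ma => _ [_ [/(_ s)[m0 p0] _]].
by rewrite m0 p0 lerDl lerDr.
Qed.

Lemma density_out s : ~ (0 <= s <= 1) -> fm s = 0 /\ fp s = 0.
Proof. by case: ma => _ [_ [_ [+ _]]]; exact. Qed.

Lemma density_uintegrable : uintegrable fm /\ uintegrable fp.
Proof.
have [mm mp] := density_measurable.
have int1 (g : R -> R) : measurable_fun setT g -> (forall s, 0 <= g s) ->
    (\int[@lebesgue_measure R]_(s in `[0%R, 1%R]) (g s)%:E)%E = 1%E -> uintegrable g.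
  move=> mg g0 g1; apply/integrableP; split.
    exact/measurable_EFinP/measurable_funTS.
  rewrite (_ : (\int[_]_(_ in _) _)%E = 1%E) ?ltry//.
  by rewrite -g1; apply: eq_integral => t _; rewrite /= ger0_norm.
case: ma => _ [_ [d0 [_ [[m1 p1] _]]]].
by split; apply: int1 => // s; case: (d0 s).
Qed.

Lemma density_uint : uint fm = 1 /\ uint fp = 1.
Proof.
by case: ma => _ [_ [_ [_ [[m1 p1] _]]]]; split; [move: m1|move: p1];
  rewrite /uint /Rintegral => ->.
Qed.

(** The normalization solved for the densities; where both densities vanish the identities are
    trivial. *)
Lemma posteriorE s : fp s = s * (fm s + fp s) /\ fm s = (1 - s) * (fm s + fp s).
Proof.
have [/andP[m0 _] /andP[p0 _]] := density_le s.
have := addr_ge0 m0 p0; rewrite le_eqVlt => /predU1P[h0|hpos].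
  by rewrite -h0 !mulr0; split; lra.
case: ma => _ [_ [_ [_ [_ [_ [+ _]]]]]].
move=> /(_ s hpos); move: hpos; move: (fm s) (fp s) => M P hpos E.
have -> : s = P / (M + P) by rewrite -E; field; rewrite ?gt_eqF//; lra.
by split; field; rewrite gt_eqF.
Qed.

Lemma fmixE s : fp s = 2 * (s * f s) /\ fm s = 2 * ((1 - s) * f s).
Proof.
have [p m_] := posteriorE s.
by split; [rewrite {1}p|rewrite {1}m_]; rewrite /f /fmix; field.
Qed.

Lemma fmix_unit_density : unit_density f.
Proof.
have [mm mp] := density_measurable; have [im ip] := density_uintegrable.
have fE : f = (fun s => 2^-1 * fm s + 2^-1 * fp s).
  by apply/funext => s; rewrite /f /fmix; field.
split.
- by rewrite fE; apply: measurable_funD; exact: measurable_funM.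
- move=> s; have [/andP[m0 _] /andP[p0 _]] := density_le s.
  by rewrite divr_ge0// addr_ge0.
- by move=> s /density_out[]; rewrite /f /fmix => -> ->; rewrite addr0 mul0r.
- by rewrite fE; apply: uintegrableD; exact: uintegrableZ.
- have [m1 p1] := density_uint.
  rewrite fE uintD; [|exact: uintegrableZ..].
  by rewrite !uintZ// m1 p1; field.
Qed.

Let ih : uintegrable (fun s => fm s + fp s).
Proof. by have [im ip] := density_uintegrable; exact: uintegrableD. Qed.

(** By [fmixE] the factor [fmix fm fp s] cancels; what is left is the value that type [s] attaches
    to the option of report [r]. *)
Lemma cond_payoffE n (x : R * (n.-1).-tuple R -> R) s r : is_type fm fp s ->
  cond_payoff fm fp x s r = s * interim fp x r - (1 - s) * interim fm x r.
Proof.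
rewrite /is_type /cond_payoff -/f => fs; have [-> ->] := fmixE s.
by rewrite /interim; field; rewrite gt_eqF.
Qed.

Lemma exp_allocE n (x : R * (n.-1).-tuple R -> R) : is_mechanism x ->
  exp_alloc fm fp x =
  uint (fun s => f s * (s * interim fp x s + (1 - s) * interim fm x s)).
Proof.
move=> [mx x01]; apply: eq_uint => s _.
have [mm mp] := density_measurable.
have dm := cube_dom_interim mm (fun s => (density_le s).1) mx x01 s.
have dp := cube_dom_interim mp (fun s => (density_le s).2) mx x01 s.
have [/andP[m0 _] /andP[p0 _]] := density_le s.
transitivity (cube_int (fun t => fp s / 2 * (x (s, t) * \prod_(y <- t) fp y) +
    fm s / 2 * (x (s, t) * \prod_(y <- t) fm y))).
  by congr cube_int; apply/funext => t; ring.
rewrite (cube_intD ih); last 2 first.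
- by apply: cube_domZ dp; rewrite divr_ge0.
- by apply: cube_domZ dm; rewrite divr_ge0.
rewrite (cube_intZ ih _ dp) (cube_intZ ih _ dm).
have [-> ->] := fmixE s; by rewrite -/(interim fp x s) -/(interim fm x s); field.
Qed.

(** The interim probabilities turn a feasible mechanism into a menu, to which [screening_ub] applies
    with the coefficients from [gain_dual]. The bound is the same in every market. *)
Lemma exp_alloc_ub W n (x : R * (n.-1).-tuple R -> R) :
  (forall p q, 0 < q -> q <= p -> p <= 1 -> gain f p q + gain f (1 - p) (1 - q) <= W) ->
  feasible fm fp x -> exp_alloc fm fp x <= W.
Proof.
move=> Wub [mech cP cIC].
have df := fmix_unit_density.
have [l1 [l2 [l10 l20 <- gl]]] := gain_dual df Wub.
rewrite exp_allocE//; case: mech => mx x01.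
have [mm mp] := density_measurable; have [im ip] := density_uintegrable.
have [um up] := density_uint.
have bm := fun s => (density_le s).1; have bp := fun s => (density_le s).2.
case: ma => _ [_ [_ [_ [_ [_ [_ [a [b [a0 [ab [b1 [fab [abf _]]]]]]]]]]]]].
apply: (@screening_ub _ _ df a b fab abf) => //.
- exact: (measurable_interim ih mp bp mx x01).
- exact: (measurable_interim ih mm bm mx x01).
- exact: (interim01 ih mp bp ip up mx x01).
- exact: (interim01 ih mm bm im um mx x01).
- by move=> s fs; rewrite -cond_payoffE//; exact: cP.
- by move=> s r fs fr; rewrite -!cond_payoffE//; exact: cIC.
Qed.

End Model.

(** * Tails of the likelihood ratio and their continuity *)

Section LikelihoodRatio.
Context {R : realType}.
Implicit Types (phi h : R -> R) (c : R).

Lemma measurable_odds : measurable_fun setT (fun y : R => y / (1 - y)).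
Proof.
apply: measurable_funM => //; apply: (measurableT_comp measurable_inv).
exact: measurable_funB.
Qed.

Lemma measurable_LR m : measurable_fun setT (@LR R m).
Proof. exact: (measurable_tuple_prod measurable_odds). Qed.

Lemma LR_ge0 m (t : m.-tuple R) :
  (forall y, y \in val t -> 0 < y < 1) -> 0 <= LR t.
Proof.
move=> t01; rewrite /LR big_seq; apply: prodr_ge0 => y /t01/andP[y0 y1].
by rewrite divr_ge0 ?subr_ge0// ltW.
Qed.

(** Probability that the likelihood-ratio test with threshold [c] accepts, for [m] independent
    signals of density [phi]. *)
Definition LRtail phi m c : R :=
  cube_int (fun t : m.-tuple R => (if c <= LR t then 1 else 0) * \prod_(y <- t) phi y).

Lemma cube_dom_LRtail phi h m c : measurable_fun setT phi ->
  (forall s, 0 <= phi s <= h s) ->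
  cube_dom h (fun t : m.-tuple R => (if c <= LR t then 1 else 0) * \prod_(y <- t) phi y).
Proof.
move=> mphi phih; have phi0 s : 0 <= phi s by case/andP: (phih s).
apply: (cube_dom_le (g2 := fun t => \prod_(y <- t) phi y)); last exact: cube_dom_prod.
- apply: measurable_funM; last exact: measurable_tuple_prod.
  by apply: measurable_fun_ifT => //; apply: measurable_fun_ler => //; exact: measurable_LR.
- by move=> t; case: ifP => _; rewrite ?mul1r ?mul0r ?lexx ?prod_ge0.
Qed.

Section Density.
Variable phi : R -> R.
Hypothesis mphi : measurable_fun setT phi.
Hypothesis phi0 : forall s, 0 <= phi s.
Hypothesis iphi : uintegrable phi.
Hypothesis uphi : uint phi = 1.

Let phi_le s : 0 <= phi s <= phi s. Proof. by rewrite phi0 lexx. Qed.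

Lemma LRtail01 m c : 0 <= LRtail phi m c <= 1.
Proof.
apply/andP; split.
  by apply: cube_int_ge0 => t; case: ifP => _; rewrite ?mul1r ?mul0r// prod_ge0.
rewrite -(expr1n R m) -uphi -cube_int_prod//.
apply: (le_cube_int iphi); [exact: cube_dom_LRtail|exact: cube_dom_prod|].
by move=> t _; case: ifP => _; rewrite ?mul1r ?mul0r ?prod_ge0.
Qed.

Lemma LRtail0 m : LRtail phi m 0 = 1.
Proof.
rewrite -(expr1n R m) -uphi -cube_int_prod//.
apply: (eq_cube_int iphi); [exact: cube_dom_LRtail|exact: cube_dom_prod|].
by move=> t /LR_ge0 ->; rewrite mul1r.
Qed.

Lemma LRtail1 c :
  LRtail phi 1 c = uint (fun s => phi s * (if c <= s / (1 - s) then 1 else 0)).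
Proof.
apply: eq_uint => s _ /=; rewrite /LR !big_cons !big_nil !mulr1 mulrC.
by [].
Qed.

Let iLRtail m c :
  measurable_fun setT (LRtail phi m) ->
  uintegrable (fun s => phi s * LRtail phi m (c * ((1 - s) / s))).
Proof.
move=> mL; apply: uintegrable_dom iphi _ _.
  apply: measurable_funM => //; apply: (measurableT_comp mL).
  apply: measurable_funM => //; apply: measurable_funM; last exact: measurable_inv.
  exact: measurable_funB.
move=> s; have /andP[L0 L1] := LRtail01 m (c * ((1 - s) / s)).
by rewrite normrM !ger0_norm// ler_piMr.
Qed.

(** Reading one signal [s] divides the threshold by its odds; this needs [0 < s < 1], so the
    endpoints are discarded as null. *)
Lemma LRtailS m c : measurable_fun setT (LRtail phi m) ->
  LRtail phi m.+1 c = uint (fun s => phi s * LRtail phi m (c * ((1 - s) / s))).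
Proof.
move=> mL; rewrite {1}/LRtail cube_intS; apply: eq_uint_oo; [|exact: iLRtail|].
  exact: (cube_dom_uintegrable iphi (cube_dom_LRtail m.+1 c mphi phi_le)).
move=> s /andP[s0 s1].
rewrite /LRtail -(cube_intZ iphi _ (cube_dom_LRtail _ _ mphi phi_le)).
congr cube_int; apply/funext => u; rewrite /LR !big_cons -/(LR u).
rewrite mulrCA; congr (_ * (_ * _)).
have s1' : 0 < 1 - s by rewrite subr_gt0.
by rewrite mulrA ler_pdivrMr// mulrAC ler_pdivlMr// [LR u * s]mulrC.
Qed.

(* Conditioning on one signal turns the tail of [LR] into an integral of tails
   that depend continuously on the threshold. *)
Lemma continuous_LRtail m : continuous (LRtail phi m.+1).
Proof.
elim: m => [|m IH].
  rewrite (_ : LRtail phi 1 = fun c => uint (fun s => phi s * (if c <= s / (1 - s) then 1 else 0))); last first.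
    by apply/funext => c; exact: LRtail1.
  apply: continuous_tail => //; first exact: measurable_odds.
  (* The odds [t / (1 - t)] can equal [c] only at this point. *)
  move=> c; exists (c / (1 + c)) => t /andP[t0 t1]; apply: contra => /eqP <-.
  have t1' : 1 - t != 0 by rewrite subr_eq0 gt_eqF.
  by apply/eqP; field; rewrite t1' subrK oner_neq0.
have mL : measurable_fun setT (LRtail phi m.+1) by exact: continuous_measurable_fun.
rewrite (_ : LRtail phi m.+2 = fun c => uint (fun s => phi s * LRtail phi m.+1 (c * ((1 - s) / s)))); last first.
  by apply/funext => c; exact: LRtailS.
move=> c.
apply: (@continuity_under_integral R _ _ (@lebesgue_measure R)
  (fun c s => phi s * LRtail phi m.+1 (c * ((1 - s) / s)))
  `[0%R, 1%R]%classic (measurable_itv _) (c - 1) (c + 1) _ _ phi iphi) => //.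
- by move=> x _; exact: iLRtail.
- apply/aeW => s _ x _; apply: (@cvgM R^o) => //; first exact: cvg_cst.
  apply: (@continuous_comp _ _ _ (fun c => c * ((1 - s) / s)) (LRtail phi m.+1)).
    by apply: (@cvgM R^o); [exact: cvg_id|exact: cvg_cst].
  exact: IH.
- move=> x _; apply/aeW => s _.
  have /andP[L0 L1] := LRtail01 m.+1 (x * ((1 - s) / s)).
  by rewrite normrM !ger0_norm// ler_piMr.
- by rewrite inE/= in_itv/=; apply/andP; split; lra.
Qed.

End Density.

(** * Likelihood-ratio tests under the two signal laws *)

Section TwoDensities.
Context {fm fp : R -> R}.
Hypothesis ma : model_assumptions fm fp.
Let h s := fm s + fp s.

Let mm : measurable_fun setT fm. Proof. by case: (density_measurable ma). Qed.
Let mp : measurable_fun setT fp. Proof. by case: (density_measurable ma). Qed.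
Let bm s : 0 <= fm s <= h s. Proof. by case: (density_le ma s). Qed.
Let bp s : 0 <= fp s <= h s. Proof. by case: (density_le ma s). Qed.
Let m0 s : 0 <= fm s. Proof. by case/andP: (bm s). Qed.
Let p0 s : 0 <= fp s. Proof. by case/andP: (bp s). Qed.
Let im : uintegrable fm. Proof. by case: (density_uintegrable ma). Qed.
Let ip : uintegrable fp. Proof. by case: (density_uintegrable ma). Qed.
Let um : uint fm = 1. Proof. by case: (density_uint ma). Qed.
Let up : uint fp = 1. Proof. by case: (density_uint ma). Qed.
Let ih : uintegrable h. Proof. exact: uintegrableD. Qed.

(** The normalization gives [fp y = y / (1 - y) * fm y] at each signal, so [LR] is a genuine
    likelihood ratio. *)
Lemma LR_densities m (t : m.-tuple R) : (forall y, y \in val t -> 0 < y < 1) ->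
  \prod_(y <- t) fp y = LR t * \prod_(y <- t) fm y.
Proof.
move=> t01; rewrite /LR -big_split/= big_seq [RHS]big_seq.
apply: eq_bigr => y /t01/andP[y0 y1]; have [-> ->] := fmixE ma y.
by field; rewrite subr_eq0 gt_eqF.
Qed.

(** Change of measure: on the acceptance region the likelihood of the state +1 is at least [c] times
    that of -1. *)
Lemma LRtail_Markov m c : 0 <= c -> c * LRtail fm m c <= LRtail fp m c.
Proof.
move=> c0; rewrite /LRtail -(cube_intZ ih _ (cube_dom_LRtail _ _ mm bm)).
apply: (le_cube_int ih).
- by apply: cube_domZ => //; exact: cube_dom_LRtail.
- exact: cube_dom_LRtail.
move=> t /LR_densities ->; case: ifP => cL; last by rewrite !mul0r mulr0.
by rewrite !mul1r ler_wpM2r// prod_ge0.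
Qed.

(** Intermediate value theorem for the difference of the two sides, nonnegative at 0 and, by
    [LRtail_Markov], nonpositive at [r^-1]. The bound on [c] is uniform in [m], as the Hellinger
    estimate requires. *)
Lemma LR_threshold m r : 0 < r -> r <= 1 ->
  exists c, [/\ 0 <= c, c <= r^-1 & LRtail fm m.+1 c = r * LRtail fp m.+1 c].
Proof.
move=> r0 r1.
pose d c := LRtail fm m.+1 c - r * LRtail fp m.+1 c.
have dc : continuous d.
  move=> c; apply: cvgB; first exact: continuous_LRtail.
  by apply: (@cvgM R^o); [exact: cvg_cst|exact: continuous_LRtail].
have d0 : 0 <= d 0 by rewrite /d !LRtail0// mulr1 subr_ge0.
have d1 : d r^-1 <= 0.
  have rV0 : 0 <= r^-1 by rewrite invr_ge0 ltW.
  have := LRtail_Markov m.+1 rV0.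
  by rewrite /d subr_le0 ler_pdivrMl.
have rV0 : 0 <= r^-1 by rewrite invr_ge0 ltW.
have [||c + dc0] := @IVT R d 0 r^-1 0 rV0.
- by apply: continuous_subspaceT => x; exact: dc.
- by rewrite ge_min le_max d0 d1 orbT.
rewrite in_itv/= => /andP[c0 cr]; exists c; split=> //.
by apply/eqP; rewrite -subr_eq0; apply/eqP.
Qed.

(** Its integral is the Hellinger affinity, or Bhattacharyya coefficient, of the two signal laws. *)
Definition affinity s : R := Num.sqrt (fp s * fm s).

Lemma affinity_ge0 s : 0 <= affinity s. Proof. exact: sqrtr_ge0. Qed.

Lemma affinity_sqr s : affinity s ^+ 2 = fp s * fm s.
Proof. by rewrite sqr_sqrtr// mulr_ge0. Qed.

Lemma measurable_affinity : measurable_fun setT affinity.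
Proof.
apply: (measurableT_comp (continuous_measurable_fun (@sqrt_continuous R))).
exact: measurable_funM.
Qed.

Lemma affinity_le s : affinity s <= fmix fm fp s.
Proof.
have f0 : 0 <= fmix fm fp s by rewrite divr_ge0// addr_ge0.
rewrite -(ler_pXn2r (n:=2))// ?nnegrE ?affinity_ge0// affinity_sqr /fmix.
by have := sqr_ge0 (fp s - fm s); lra.
Qed.

Let affinity_leh s : 0 <= affinity s <= h s.
Proof.
rewrite affinity_ge0 (le_trans (affinity_le s))// /fmix ler_pdivrMr//.
by rewrite -/(h s) ler_peMr ?ler1n// addr_ge0.
Qed.

Let iaff : uintegrable affinity.
Proof.
apply: uintegrable_dom ih measurable_affinity _ => s.
by have /andP[? ?] := affinity_leh s; rewrite ger0_norm.
Qed.

(** The geometric mean of the densities lies below their arithmetic mean [fmix], strictly on []a,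
    b[] except at [s = 1 / 2]. *)
Lemma affinity_lt1 : uint affinity < 1.
Proof.
have df := fmix_unit_density ma; case: (df) => mf f0 _ if_ f1.
have im1 : uintegrable (fun s => - 1 * affinity s) by exact: uintegrableZ.
rewrite -subr_gt0 -f1 -[X in _ < _ + X]mulN1r -uintZ// -uintD//.
case: ma => _ [_ [_ [_ [_ [_ [_ [a [b [a0 [ab [b1 [_ [abf _]]]]]]]]]]]]].
apply: (@uint_gt0 _ a b (1 / 2)) => //.
- by apply: measurable_funD => //; apply: measurable_funM => //; exact: measurable_affinity.
- by move=> s; rewrite mulN1r subr_ge0 affinity_le.
- exact: uintegrableD.
move=> s /abf fs s12; rewrite mulN1r subr_gt0 lt_neqAle affinity_le andbT.
apply/eqP => E; have : affinity s ^+ 2 = (fmix fm fp s) ^+ 2 by rewrite E.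
rewrite affinity_sqr; have [-> ->] := fmixE ma s; move/eqP; apply/negP.
(* This rests on [1 - 4 s (1 - s) = (2 s - 1)^2]. *)
have -> : (2 * (s * fmix fm fp s) * (2 * ((1 - s) * fmix fm fp s)) == fmix fm fp s ^+ 2) =
   ((2 * s - 1) ^+ 2 * fmix fm fp s ^+ 2 == 0).
  by rewrite -subr_eq0 -oppr_eq0; congr (_ == 0); ring.
apply: mulf_neq0; apply: expf_neq0; last by rewrite gt_eqF.
by apply: contra s12 => /eqP ?; apply/eqP; lra.
Qed.

(* Hellinger bound: on [LR < c] the likelihood of omega = +1 is at most
   [sqrt c] times the geometric mean of the two likelihoods. *)
Lemma LRtail_affinity m c : 0 <= c ->
  1 - LRtail fp m c <= Num.sqrt c * uint affinity ^+ m.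
Proof.
move=> c0; rewrite lerBlDl -{1}(expr1n R m) -{1}up -!cube_int_prod//.
have da : cube_dom h (fun t : m.-tuple R => \prod_(y <- t) affinity y).
  exact: cube_dom_prod measurable_affinity affinity_leh.
rewrite -(cube_intZ ih _ da) -(cube_intD ih); last 2 first.
- exact: cube_dom_LRtail.
- by apply: cube_domZ => //; exact: sqrtr_ge0.
apply: (le_cube_int ih).
- exact: cube_dom_prod.
- by apply: cube_domD; [exact: cube_dom_LRtail|apply: cube_domZ => //; exact: sqrtr_ge0].
move=> t t01; have a0 : 0 <= \prod_(y <- t) affinity y by apply: prod_ge0; exact: affinity_ge0.
case: ifPn => cL; first by rewrite mul1r lerDl mulr_ge0// sqrtr_ge0.
(* Where the test rejects, compare squares and write one factor [\prod fp] as [LR t * \prod fm],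
   with [LR t <= c]. *)
rewrite mul0r add0r -(ler_pXn2r (n:=2))// ?nnegrE ?prod_ge0 ?mulr_ge0 ?sqrtr_ge0//.
have aE : (\prod_(y <- t) affinity y) ^+ 2 = \prod_(y <- t) fp y * \prod_(y <- t) fm y.
  rewrite -prodrXl -big_split/=; apply: eq_bigr => y _; exact: affinity_sqr.
rewrite exprMn aE sqr_sqrtr// expr2 mulrCA ler_wpM2l ?prod_ge0//.
rewrite (LR_densities t01) ler_wpM2r ?prod_ge0//.
by rewrite ltW// ltNge.
Qed.

End TwoDensities.
End LikelihoodRatio.

(** * Threshold mechanisms and the lower bound *)

Section ThresholdMechanism.
Context {R : realType} {fm fp : R -> R}.
Hypothesis ma : model_assumptions fm fp.

Let mm : measurable_fun setT fm. Proof. by case: (density_measurable ma). Qed.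
Let mp : measurable_fun setT fp. Proof. by case: (density_measurable ma). Qed.
Let m0 s : 0 <= fm s. Proof. by case: (density_le ma s) => /andP[]. Qed.
Let p0 s : 0 <= fp s. Proof. by case: (density_le ma s) => _ /andP[]. Qed.
Let im : uintegrable fm. Proof. by case: (density_uintegrable ma). Qed.
Let ip : uintegrable fp. Proof. by case: (density_uintegrable ma). Qed.
Let um : uint fm = 1. Proof. by case: (density_uint ma). Qed.
Let up : uint fp = 1. Proof. by case: (density_uint ma). Qed.

(** For [q <= p], the best choice of type [s] among [(0, 0)], [(p, q)] and [(1, 1)], ties going
    upward. The middle outcome [v] is a parameter so that one formula serves for allocations and for
    interim probabilities. *)
Definition menu3 (p q v s : R) : R :=
  if s * p < (1 - s) * q then 0 else
  if s * (1 - p) < (1 - s) * (1 - q) then v else 1.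

Definition tmech m (p q k c : R) (st : R * m.-tuple R) : R :=
  menu3 p q (k * (if c <= LR st.2 then 1 else 0)) st.1.

Lemma interim_tmech (phi : R -> R) m p q k c s :
  measurable_fun setT phi -> (forall s, 0 <= phi s) -> uintegrable phi -> uint phi = 1 ->
  interim phi (@tmech m p q k c) s = menu3 p q (k * LRtail phi m c) s.
Proof.
move=> mphi phi0 iphi uphi.
have phi_le y : 0 <= phi y <= phi y by rewrite phi0 lexx.
have dphi : cube_dom phi (fun t : m.-tuple R => \prod_(y <- t) phi y) by exact: cube_dom_prod.
rewrite /interim /tmech /menu3 /=; case: ifP => _.
  by rewrite (cube_intZ iphi _ dphi) mul0r.
case: ifP => _.
  rewrite /LRtail -(cube_intZ iphi _ (cube_dom_LRtail _ _ mphi phi_le)).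
  by congr cube_int; apply/funext => t; rewrite mulrA.
by rewrite (cube_intZ iphi _ dphi) cube_int_prod// uphi expr1n mul1r.
Qed.

Lemma measurable_tmech m p q k c : measurable_fun setT (@tmech m p q k c).
Proof.
have m1 (u : R) : measurable_fun setT (fun st : R * m.-tuple R => st.1 * u).
  by apply: measurable_funM.
have m2 (u : R) : measurable_fun setT (fun st : R * m.-tuple R => (1 - st.1) * u).
  by apply: measurable_funM => //; exact: measurable_funB.
apply: measurable_fun_ifT => //; first exact: measurable_fun_ltr.
apply: measurable_fun_ifT => //; first exact: measurable_fun_ltr.
apply: measurable_funM => //; apply: measurable_fun_ifT => //.
apply: measurable_fun_ler => //.
exact: (measurableT_comp (@measurable_LR R m)).
Qed.

Definition threshold_mechanism n (smin smax k c : R) (x : R * (n.-1).-tuple R -> R) : Prop :=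
  [/\ smin <= smax, 0 <= k <= 1, 0 <= c, threshold_form smin smax k c x &
      feasible fm fp x].

(** The menu is consistent: [p] and [q] are the interim probabilities that the scaled test itself
    produces. The cutoffs are the types indifferent between [(0, 0)] and [(p, q)], and between
    [(p, q)] and [(1, 1)]; [q <= p] puts them in order. Every type gets a favourite option, whence
    (P) and (IC). *)
Lemma tmech_threshold n (k c : R) :
  let p := k * LRtail fp n.-1 c in let q := k * LRtail fm n.-1 c in
  0 <= k -> k < 1 -> 0 <= c -> 0 < p -> q <= p ->
  threshold_mechanism (n := n) (q / (p + q)) ((1 - q) / ((1 - p) + (1 - q))) k c
    (@tmech n.-1 p q k c) /\
  exp_alloc fm fp (n := n) (@tmech n.-1 p q k c) =
    gain (fmix fm fp) p q + gain (fmix fm fp) (1 - p) (1 - q).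
Proof.
move=> p q k0 k1 c0 p_gt0 qp.
have /andP[a0 a1] := LRtail01 mp p0 ip up n.-1 c.
have /andP[b0 b1] := LRtail01 mm m0 im um n.-1 c.
have q0 : 0 <= q by exact: mulr_ge0.
have p1 : p < 1 by rewrite /p; nra.
have pq0 : 0 < p + q by lra.
have pq1 : 0 < 1 - p + (1 - q) by lra.
have ifpE := interim_tmech n.-1 p q k c _ mp p0 ip up.
have ifmE := interim_tmech n.-1 p q k c _ mm m0 im um.
have mech : is_mechanism (n := n) (@tmech n.-1 p q k c).
  split; first exact: measurable_tmech.
  move=> st; rewrite /tmech /menu3; do 2 (case: ifP => _; rewrite ?lexx ?ler01//).
  by case: ifP => _; rewrite ?mulr1 ?mulr0 ?lexx ?ler01// k0 ltW.
split; last first.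
  have df := fmix_unit_density ma.
  have i1 := uintegrable_gain df (ltW p_gt0) q0.
  have p1' : 0 <= 1 - p by lra.
  have q1' : 0 <= 1 - q by lra.
  have i2 := uintegrable_gain df p1' q1'.
  rewrite exp_allocE// /gain -(uintD i1 i2).
  apply: eq_uint => s /andP[s0 s1]; rewrite ifpE ifmE -/p -/q /menu3 /accept -mulrDr.
  congr (_ * _); have [A|A] := ltP (s * p) ((1 - s) * q).
    (* Rejecting [(p, q)] forces [s < 1 - s], as [q <= p], and then the upgrade is rejected too. *)
    by rewrite leNgt ifN; [ring|rewrite negbK; nra].
  by case: (ltP (s * (1 - p)) ((1 - s) * (1 - q))) => B; ring.
split.
- rewrite ler_pdivrMr// mulrAC ler_pdivlMr//; nra.
- by rewrite k0 ltW.
- by [].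
- move=> s t; rewrite /tmech /menu3 /=.
  have [A|A] := ltP (s * p) ((1 - s) * q).
    by left; split=> //; rewrite ler_pdivlMr//; lra.
  have A' : q / (p + q) <= s by rewrite ler_pdivrMr//; lra.
  have [B|B] := ltP (s * (1 - p)) ((1 - s) * (1 - q)).
    by right; left; split=> //; rewrite A' ler_pdivlMr//; lra.
  by right; right; split=> //; rewrite ler_pdivrMr//; lra.
- split=> // [s ts|s r ts tr]; rewrite !cond_payoffE// !ifpE !ifmE -/p -/q /menu3.
    have [A|A] := ltP (s * p) ((1 - s) * q); first by rewrite !mulr0 subrr.
    by case: (ltP (s * (1 - p)) ((1 - s) * (1 - q))) => B; lra.
  have s01 : 0 <= s <= 1.
    apply: contraPT ts => /negP/(density_out ma)[sm sp].
    by rewrite /is_type /fmix sm sp addr0 mul0r ltxx.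
  case/andP: s01 => s0 s1.
  have [A|A] := ltP (s * p) ((1 - s) * q);
    have [B|B] := ltP (s * (1 - p)) ((1 - s) * (1 - q));
    have [C|C] := ltP (r * p) ((1 - r) * q);
    have [E|E] := ltP (r * (1 - p)) ((1 - r) * (1 - q)); rewrite ?mulr0 ?mulr1; nra.
Qed.

(* Scaling the target option by [a <= 1] keeps both gains under control: the
   gain of the middle option is homogeneous, and that of the upgrade grows. *)
Lemma threshold_mechanism_approx p q e : 0 < q -> q <= p -> p <= 1 -> 0 < e ->
  \forall n \near \oo, exists smin smax k c (x : R * (n.-1).-tuple R -> R),
    threshold_mechanism smin smax k c x /\
    gain (fmix fm fp) p q + gain (fmix fm fp) (1 - p) (1 - q) - e <= exp_alloc fm fp x.
Proof.
move=> q0 qp p1 e0; have df := fmix_unit_density ma.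
have p_gt0 : 0 < p by exact: lt_le_trans qp.
pose r := q / p.
have r0 : 0 < r by rewrite divr_gt0.
have r1 : r <= 1 by rewrite ler_pdivrMr// mul1r.
(* Below, [1 - a <= 2 * d] and the gain is at most 2, so the loss is at most [4 * d <= e]. *)
pose d := Num.min (1 / 2) (e / 4).
have d0 : 0 < d by rewrite lt_min; apply/andP; split; lra.
have d1 : d <= 1 / 2 by rewrite ge_min lexx.
have de : d <= e / 4 by rewrite ge_min lexx orbT.
have rho0 : 0 <= uint (@affinity R fm fp) by apply: uint_ge0 => s _; exact: affinity_ge0.
have rho1 := affinity_lt1 ma.
have sr0 : 0 < Num.sqrt r^-1 by rewrite sqrtr_gt0 invr_gt0.
have : `|uint (@affinity R fm fp)| < 1 by rewrite ger0_norm.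
move/cvg_expr => /cvgrPdist_le /(_ (d / Num.sqrt r^-1)).
rewrite divr_gt0// => /(_ isT)[N _ Nd].
(* There are [n.-1] other signals; [N.+2] leaves at least one, as [LR_threshold] requires, and at
   least [N]. *)
exists N.+2 => // n /= Nn.
have [m nm] : exists m, n.-1 = m.+1 by exists n.-2; case: n Nn => [|[|n]].
have Nm : (N <= m.+1)%N by rewrite -nm; case: n Nn {nm} => // n; rewrite ltnS => /ltnW.
have {Nd} := Nd _ Nm; rewrite /= sub0r normrN ger0_norm ?exprn_ge0//.
rewrite ler_pdivlMr// mulrC => rhod.
have [c [c0 cr bE]] := LR_threshold ma m r0 r1.
have aL := le_trans (LRtail_affinity ma m.+1 c0) (le_trans (ler_wpM2r (exprn_ge0 _ rho0) (ler_wsqrtr cr)) rhod).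
rewrite -nm in bE aL.
have /andP[_ a1] := LRtail01 mp p0 ip up n.-1 c.
set al := LRtail fp n.-1 c in bE aL a1.
(* Scaling the test by [(1 - d) * p] realises the middle option [(a * p, a * q)]; the factor [1 - d]
   keeps [a] and the scale below 1. *)
pose a := (1 - d) * al.
have a_gt0 : 0 < a by rewrite mulr_gt0//; lra.
have a_lb : 1 - 2 * d <= a by rewrite /a; nra.
have a_lt1 : a < 1 by rewrite /a; nra.
have pE : (1 - d) * p * LRtail fp n.-1 c = a * p by rewrite -/al /a; ring.
have qE : (1 - d) * p * LRtail fm n.-1 c = a * q.
  by rewrite bE /a /r; field; rewrite gt_eqF.
have := @tmech_threshold n ((1 - d) * p) c; rewrite /= pE qE => tm.
have [||//|||ok val] := tm.
- by apply: mulr_ge0; lra.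
- by nra.
- by rewrite mulr_gt0.
- by rewrite ler_pM2l.
do 5 eexists; split; first exact: ok.
rewrite val (gainZ df (ltW a_gt0) (ltW p_gt0) (ltW q0)).
have e1 : 0 <= 1 - a by lra.
have := gain_add df (ltW q0) qp p1 e1.
have -> : 1 - p + (1 - a) * p = 1 - a * p by ring.
have -> : 1 - q + (1 - a) * q = 1 - a * q by ring.
have g0 := gain_ge0 df (ltW p_gt0) (ltW q0).
have g2 := gain_le df (ltW p_gt0) (ltW q0).
have : (1 - a) * gain (fmix fm fp) p q <= (2 * d) * 2.
  by apply: ler_pM => //; lra.
by lra.
Qed.

(** Threshold 0 accepts almost surely, so scaling by 1/2 makes [(1 / 2, 1 / 2)] the middle option in
    a market of any size. *)
Lemma threshold_mechanism_exists n : exists smin smax k c (x : R * (n.-1).-tuple R -> R),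
  threshold_mechanism smin smax k c x.
Proof.
have := @tmech_threshold n (1 / 2) 0; rewrite /= !LRtail0// mulr1 => tm.
have [||//|||ok _] := tm; [by lra|by lra|by lra|by []|].
by do 5 eexists; exact: ok.
Qed.

End ThresholdMechanism.
Arguments threshold_mechanism {R} fm fp {n} smin smax k c x.

(** * Squeezing the optimal value against near-best threshold mechanisms *)

Unset Implicit Arguments.

Theorem theorem3 (R : realType) (fm fp : R -> R) :
  model_assumptions fm fp ->
  exists (smin smax kappa tau : nat -> R)
         (xs : forall n : nat, R * (n.-1).-tuple R -> R),
    (forall n : nat, (2 <= n)%N ->
       [/\ smin n <= smax n, 0 <= kappa n <= 1, 0 <= tau n,
           threshold_form (smin n) (smax n) (kappa n) (tau n) (xs n) &
           feasible fm fp (xs n)])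
    /\ (fun n => `|Vopt fm fp n - exp_alloc fm fp (xs n)|) @ \oo --> 0.
Proof.
move=> ma; have df := fmix_unit_density ma.
pose G p q := gain (fmix fm fp) p q + gain (fmix fm fp) (1 - p) (1 - q).
pose SW := [set v | exists p q, [/\ 0 < q, q <= p, p <= 1 & v = G p q]].
have SW1 : SW (G 1 1) by exists 1, 1; split=> //; exact: ltr01.
have SWub : ubound SW 2.
  move=> _ [p [q [q0 qp p1 ->]]]; rewrite /G.
  have h1 : 0 <= p by lra.
  have h2 : 0 <= 1 - p by lra.
  have h3 : 0 <= 1 - q by lra.
  by have := gain_le df h1 (ltW q0); have := gain_le df h2 h3; lra.
pose W := sup SW.
have Wub p q : 0 < q -> q <= p -> p <= 1 -> G p q <= W.
  by move=> q0 qp p1; apply: ub_le_sup; [exists 2|exists p, q].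
have allocW n (x : R * (n.-1).-tuple R -> R) : feasible fm fp x -> exp_alloc fm fp x <= W.
  by move=> fx; exact: (exp_alloc_ub ma Wub fx).
pose T n := [set v | exists smin smax k c (x : R * (n.-1).-tuple R -> R),
  threshold_mechanism fm fp smin smax k c x /\ v = exp_alloc fm fp x].
have Tub n : ubound (T n) W.
  by move=> _ [s1 [s2 [k [c [x [[_ _ _ _ fx] ->]]]]]]; exact: allocW.
have Tne n : T n !=set0.
  have [s1 [s2 [k [c [x tx]]]]] := threshold_mechanism_exists ma n.
  by exists (exp_alloc fm fp x), s1, s2, k, c, x.
(* The mechanism comes within [n.+1%:R^-1] of the best threshold mechanism instead of tracking a
   given option [(p, q)], so that one sequence serves every accuracy [e]. *)
have near_best n : {d : R * R * R * R * (R * (n.-1).-tuple R -> R) |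
    threshold_mechanism fm fp d.1.1.1.1 d.1.1.1.2 d.1.1.2 d.1.2 d.2 /\
    sup (T n) - n.+1%:R^-1 < exp_alloc fm fp d.2}.
  apply: cid; have n0 : 0 < n.+1%:R^-1 :> R by rewrite invr_gt0.
  have [_ [s1 [s2 [k [c [x [tx ->]]]]]] lt] := sup_adherent n0 (conj (Tne n) (ex_intro _ W (Tub n))).
  by exists (s1, s2, k, c, x).
pose d n := sval (near_best n).
have dP n := svalP (near_best n).
exists (fun n => (d n).1.1.1.1), (fun n => (d n).1.1.1.2), (fun n => (d n).1.1.2),
  (fun n => (d n).1.2), (fun n => (d n).2).
split; first by move=> n _; exact: (dP n).1.
apply/cvgrPdist_le => e e0.
(* Three losses of at most [e / 4] add up: from [W] to [G p q], from there to [sup (T n)], and from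
   there to the chosen mechanism. *)
have e4 : 0 < e / 4 by lra.
have [_ [p [q [q0 qp p1 ->]]] Gpq] := sup_adherent e4 (conj (ex_intro _ _ SW1) (ex_intro _ 2 SWub)).
have approx := threshold_mechanism_approx ma q0 qp p1 e4.
near=> n.
have : n.+1%:R^-1 < e / 4.
  near: n; apply: (near_infty_natSinv_lt (PosNum e4)).
have : G p q - e / 4 <= sup (T n).
  have [s1 [s2 [k [c [x [tx xG]]]]]] : exists smin smax k c (x : R * (n.-1).-tuple R -> R),
      threshold_mechanism fm fp smin smax k c x /\ G p q - e / 4 <= exp_alloc fm fp x.
    by near: n.
  apply: le_trans xG _; apply: ub_le_sup; first by exists W.
  by exists s1, s2, k, c, x.
have [[_ _ _ _ fd] dn] := dP n.
(* The optimal value is squeezed between the chosen feasible mechanism and the bound [W] common to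
   all markets. *)
have Vn : exp_alloc fm fp (d n).2 <= Vopt fm fp n <= W.
  apply/andP; split.
    apply: ub_le_sup; last by exists (d n).2.
    by exists W => _ [x [fx ->]]; exact: allocW.
  apply: ge_sup; first by exists (exp_alloc fm fp (d n).2), (d n).2.
  by move=> _ [x [fx ->]]; exact: allocW.
case/andP: Vn => V1 V2 TG nb.
rewrite sub0r normrN normr_id ger0_norm ?subr_ge0//.
rewrite -/W in Gpq; rewrite -/(d n) in dn.
move: Gpq V1 V2 TG nb dn; move: (n.+1%:R^-1) => i.
move: (exp_alloc _ _ _) (Vopt _ _ _) (sup (T n)) => E V S.
by lra.
Unshelve. all: by end_near. Qed.
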